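(* Let $\Gamma$ be a discrete subgroup of $\mathrm{GL}_2(F_\infty)$ with $\det(\Gamma)\subset\mathcal{O}_\infty^\times$. Let $r\geqslant 1$, let $H$ be a subgroup of $\Gamma$, and let $a_1,b_1,\ldots,a_r,b_r\in\mathbb{P}^1(F_\infty)$ be such that $a_i\neq b_i$ for all $i$, $\{a_i,b_i\}\neq\{a_j,b_j\}$ for $i\neq j$, and every $h\in H$ fixes every $a_i$ and every $b_i$. Consider the condition (P): for some (equivalently, all) vertices $v$ of $\mathcal{T}$ and all $N\geqslant 0$, the set $S_N(v)=\{[\gamma]\in H\backslash\Gamma : d(\gamma v,[a_i\to b_i])\leqslant N\text{ for all }1\leqslant i\leqslant r\}$ is finite. Then (P) is satisfied in each of the following cases: (i) $r=1$, $H=\langle\delta\rangle$ with $\delta\in\Gamma$ hyperbolic, and $\{a_1,b_1\}$ is the set of fixed points of $\delta$ in $\mathbb{P}^1(F_\infty)$; (ii) $r\geqslant 2$, $H=\{I\}$, and $\bigcap_{i=1}^r\{a_i,b_i\}=\emptyset$. Moreover, if $\Gamma$ is commensurable with $\mathrm{GL}_2(A)$, then (P) is also satisfied in each of the following cases: (iii) $r=1$, $H=\{I\}$, and $a_1,b_1\in\mathbb{P}^1(F)$; (iv) $r\geqslant 2$, $H=\{I\}$, and $\bigcap_{i=1}^r\{a_i,b_i\}=\{c\}$ with $c\in\mathbb{P}^1(F)$.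
   Context: $q=p^e$ is an odd prime power, $A=\mathbb{F}_q[T]$, $F=\mathbb{F}_q(T)$, $\pi=1/T$, $F_\infty=\mathbb{F}_q((\pi))$ with ring of integers $\mathcal{O}_\infty=\mathbb{F}_q[[\pi]]$ and absolute value $|\cdot|$ (extended to an algebraic closure). A matrix $\delta\in\mathrm{GL}_2(F_\infty)$ is hyperbolic if its eigenvalues $\lambda_1,\lambda_2$ satisfy $|\lambda_1|\neq|\lambda_2|$; it then has exactly two fixed points on $\mathbb{P}^1(F_\infty)$. Two subgroups $\Gamma,G$ of $\mathrm{GL}_2(F_\infty)$ are commensurable if $\Gamma\cap G$ has finite index in both. $\mathrm{GL}_2(F_\infty)$ acts on $\mathbb{P}^1(F_\infty)$ by linear fractional transformations. $\mathcal{T}$ is the Bruhat–Tits tree of $\mathrm{PGL}_2(F_\infty)$: vertices are homothety classes $[L]$ of $\mathcal{O}_\infty$-lattices $L$ of rank two in the space $F_\infty^2$ of row vectors, two being adjacent if they have representatives with $\pi L\subset L'\subset L$ (strict inclusions). $\gamma\in\mathrm{GL}_2(F_\infty)$ acts by $\gamma[L]=[L\gamma^{-1}]$. Put $v_n=[\pi^n\mathcal{O}_\infty f_1+\mathcal{O}_\infty f_2]$, with $f_1,f_2$ the canonical basis. The ends of $\mathcal{T}$ are identified $\mathrm{GL}_2(F_\infty)$-equivariantly with $\mathbb{P}^1(F_\infty)$ so that the half-line $(v_n)_{n\geqslant0}$ represents $\infty$ and $(v_{-n})_{n\geqslant 0}$ represents $0$. For distinct $a,b\in\mathbb{P}^1(F_\infty)$,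 $[a\to b]$ is the doubly infinite geodesic of $\mathcal{T}$ from $a$ to $b$; $d$ is the path distance on $\mathcal{T}$. *)

(* Defs.v *)
From HB Require Import structures.
From mathcomp Require Import all_boot all_order all_algebra.
From mathcomp Require Import all_classical all_reals ereal.

Set Implicit Arguments.
Unset Strict Implicit.
Unset Printing Implicit Defensive.

Import Order.TTheory GRing.Theory Num.Theory.
Local Open Scope classical_set_scope.
Local Open Scope ring_scope.

(** Formal power series [k[[pi]]]; [fps] is a record so that it does not inherit
    the pointwise ring structure of [nat -> k]. *)

Record fps (k : fieldType) := Fps { fps_coef :> nat -> k }.

HB.instance Definition _ (k : fieldType) := gen_eqMixin (fps k).
HB.instance Definition _ (k : fieldType) := gen_choiceMixin (fps k).

Section PowerSeries.
Variable k : fieldType.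
Implicit Types f g h : fps k.

Lemma fpsP f g : (forall n, f n = g n) -> f = g.
Proof. by case: f g => [f] [g] /= /funext ->. Qed.

Definition fps0 : fps k := Fps (fun=> 0).
Definition fps1 : fps k := Fps (fun n => (n == 0%N)%:R).
Definition fps_add f g := Fps (fun n => f n + g n).
Definition fps_opp f := Fps (fun n => - f n).
Definition fps_mul f g := Fps (fun n => \sum_(i < n.+1) f i * g (n - i)%N).

Let fps_addA : associative fps_add.
Proof. by move=> f g h; apply: fpsP => n /=; rewrite addrA. Qed.
Let fps_addC : commutative fps_add.
Proof. by move=> f g; apply: fpsP => n /=; rewrite addrC. Qed.
Let fps_add0 : left_id fps0 fps_add.
Proof. by move=> f; apply: fpsP => n /=; rewrite add0r. Qed.
Let fps_addN : left_inverse fps0 fps_opp fps_add.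
Proof. by move=> f; apply: fpsP => n /=; rewrite addNr. Qed.

HB.instance Definition _ :=
  GRing.isZmodule.Build (fps k) fps_addA fps_addC fps_add0 fps_addN.

Definition fps_trunc N f : {poly k} := \poly_(i < N.+1) f i.

Let coef_trunc N f i : (i <= N)%N -> (fps_trunc N f)`_i = f i.
Proof. by move=> iN; rewrite coef_poly ltnS iN. Qed.

Let coef_mul_trunc N f g i : (i <= N)%N ->
  (fps_trunc N f * fps_trunc N g)`_i = (fps_mul f g) i.
Proof.
move=> iN; rewrite coefM [RHS]/=; apply: eq_bigr => j _.
have ji : (j <= i)%N by rewrite -ltnS.
have jN := leq_trans ji iN; have ijN := leq_trans (leq_subr j i) iN.
by rewrite (coef_trunc f jN) (coef_trunc g ijN).
Qed.

Let coefM_eq N (p p' r r' : {poly k}) :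
    (forall i, (i <= N)%N -> p`_i = p'`_i) ->
    (forall i, (i <= N)%N -> r`_i = r'`_i) ->
  (p * r)`_N = (p' * r')`_N.
Proof.
move=> pp' rr'; rewrite !coefM; apply: eq_bigr => j _.
by rewrite pp' -1?ltnS // rr' // leq_subr.
Qed.

Let fps_mulA : associative fps_mul.
Proof.
move=> f g h; apply: fpsP => n.
rewrite -(coef_mul_trunc _ _ (leqnn n)) -[RHS](coef_mul_trunc _ _ (leqnn n)).
transitivity ((fps_trunc n f * (fps_trunc n g * fps_trunc n h))`_n).
  by apply: coefM_eq => // i ile; rewrite coef_trunc // coef_mul_trunc.
rewrite mulrA; apply: coefM_eq => // i ile.
by rewrite coef_trunc // coef_mul_trunc.
Qed.

Let fps_mulC : commutative fps_mul.
Proof.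
move=> f g; apply: fpsP => n.
by rewrite -!(coef_mul_trunc _ _ (leqnn n)) mulrC.
Qed.

Let fps_mul1 : left_id fps1 fps_mul.
Proof.
move=> f; apply: fpsP => n /=.
by rewrite big_ord_recl subn0 mul1r big1 ?addr0 // => i _; rewrite mul0r.
Qed.

Let fps_mulDl : left_distributive fps_mul fps_add.
Proof.
move=> f g h; apply: fpsP => n /=.
by rewrite -big_split; apply: eq_bigr => i _; rewrite mulrDl.
Qed.

Let fps1_neq0 : fps1 != fps0.
Proof.
apply/eqP => /(congr1 (fun f : fps k => f 0%N)) /= /eqP.
by rewrite oner_eq0.
Qed.

HB.instance Definition _ := GRing.Zmodule_isComNzRing.Build (fps k)
  fps_mulA fps_mulC fps_mul1 fps_mulDl fps1_neq0.

Definition fps_unit : pred (fps k) := fun f => `[< exists g, g * f = 1 >].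
Definition fps_inv f := xget f [set g | g * f = 1].

Let fps_mulV : {in fps_unit, left_inverse 1 fps_inv *%R}.
Proof. by move=> f /asboolP[g gf]; rewrite /fps_inv; case: xgetP => // /(_ g). Qed.
Let fps_unitP f g : g * f = 1 -> fps_unit f.
Proof. by move=> gf; apply/asboolP; exists g. Qed.
Let fps_inv_out : {in [predC fps_unit], fps_inv =1 id}.
Proof.
move=> f /asboolPn nuf; rewrite /fps_inv; case: xgetP => // g _ gf.
by case: nuf; exists g.
Qed.

HB.instance Definition _ := GRing.ComNzRing_hasMulInverse.Build (fps k)
  fps_mulV fps_unitP fps_inv_out.

(** The order of vanishing at [pi = 0], with the junk value 0 at [f = 0]. *)
Definition fps_ord f : nat :=
  if pselect (exists n, f n != 0) is left ex then ex_minn ex else 0.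

Lemma fps_ord_neq0 f : f != 0 -> f (fps_ord f) != 0.
Proof.
move=> f0; rewrite /fps_ord; case: pselect => [ex|nex]; first by case: ex_minnP.
case/eqP: f0; apply: fpsP => n; apply/eqP/negPn/negP => fn.
by apply: nex; exists n.
Qed.

Lemma fps_lt_ord f n : (n < fps_ord f)%N -> f n = 0.
Proof.
rewrite /fps_ord; case: pselect => // ex; case: ex_minnP => m _ min.
by rewrite ltnNge => /negP nm; apply/eqP/negPn/negP => /min.
Qed.

Let fps_coefM_ord f g : f != 0 -> g != 0 ->
  (f * g) (fps_ord f + fps_ord g)%N = f (fps_ord f) * g (fps_ord g).
Proof.
move=> f0 g0; have lt : (fps_ord f < (fps_ord f + fps_ord g).+1)%N.
  by rewrite ltnS leq_addr.
rewrite [LHS]/= (bigD1 (Ordinal lt)) //= addKn big1 ?addr0 // => i.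
rewrite -val_eqE /= neq_ltn => /orP[ilt|igt].
  by rewrite fps_lt_ord ?mul0r.
rewrite (@fps_lt_ord g) ?mulr0 // ltn_subLR; last by rewrite -ltnS.
by rewrite ltn_add2r.
Qed.

Let fps_integral f g : f * g = 0 -> (f == 0) || (g == 0).
Proof.
move=> fg0; apply/negPn/negP; rewrite negb_or => /andP[f0 g0].
have := fps_coefM_ord f0 g0; rewrite fg0 /= => /esym/eqP.
by rewrite mulf_eq0 (negPf (fps_ord_neq0 f0)) (negPf (fps_ord_neq0 g0)).
Qed.

HB.instance Definition _ :=
  GRing.ComUnitRing_isIntegral.Build (fps k) fps_integral.

Lemma fps_ord_min f n : f n != 0 -> (fps_ord f <= n)%N.
Proof. by move=> fn; rewrite leqNgt; apply/negP => /fps_lt_ord /eqP; apply/negP. Qed.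

Lemma fps_ordM f g : f != 0 -> g != 0 ->
  fps_ord (f * g) = (fps_ord f + fps_ord g)%N.
Proof.
move=> f0 g0; apply/eqP; rewrite eqn_leq fps_ord_min ?andTb; last first.
  by rewrite fps_coefM_ord // mulf_neq0 ?fps_ord_neq0.
rewrite leqNgt; apply/negP => lt.
have /negP := fps_ord_neq0 (mulf_neq0 f0 g0); apply; apply/eqP.
move: lt; set m := fps_ord (f * g) => lt; rewrite [LHS]/=.
apply: big1 => i _; have [ilt|ige] := ltnP i (fps_ord f).
  by rewrite fps_lt_ord ?mul0r.
rewrite (@fps_lt_ord g) ?mulr0 // ltn_subLR; last by rewrite -ltnS.
by rewrite (leq_trans lt) // leq_add2r.
Qed.

End PowerSeries.

(** [laurent k] is [k((pi))], as the fraction field of [k[[pi]]]. *)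
Notation laurent k := {fraction (fps k)}.

Section Laurent.
Variable k : fieldType.

Definition Oinf : set (laurent k) := range (@tofrac (fps k)).

Definition Oinf_unit : set (laurent k) :=
  [set x | x != 0 /\ Oinf x /\ Oinf x^-1].

Definition piinf : laurent k := tofrac (Fps (fun n => (n == 1%N)%:R)).

Definition const_inf (c : k) : laurent k :=
  tofrac (Fps (fun n => if n == 0%N then c else 0)).

(** The embedding of [A = k[T]] given by [T = 1 / pi]. *)
Definition poly_inf (p : {poly k}) : laurent k :=
  (map_poly const_inf p).[piinf^-1].

(** [F = k(T)] inside [k((pi))]. *)
Definition ratfun_inf : set (laurent k) :=
  [set x | exists p s : {poly k}, s != 0 /\ x = poly_inf p / poly_inf s].

(** The valuation of a nonzero element; by [val_inf_frac] it does not depend on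
    the numerator and denominator picked by [repr]. *)
Definition val_inf (x : laurent k) : int :=
  (fps_ord \n_(repr x))%:Z - (fps_ord \d_(repr x))%:Z.

Lemma val_inf_frac (f g : fps k) : f != 0 -> g != 0 ->
  val_inf (tofrac f / tofrac g) = (fps_ord f)%:Z - (fps_ord g)%:Z.
Proof.
move=> f0 g0; have -> : tofrac f / tofrac g = (\pi_(laurent k) (Ratio f g))%qT.
  rewrite /tofrac; unlock; rewrite -[X in _ * X]FracField.pi_inv -[LHS]FracField.pi_mul.
  by rewrite /FracField.mulf /FracField.invf /= !numden_Ratio ?oner_eq0 ?(mul1r, mulr1).
rewrite /val_inf; set y := repr _.
have := FracField.equivf_r (Ratio f g); rewrite -/y !numden_Ratio // => e.
have d0 := denom_ratioP y; have n0 : \n_y != 0.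
  by apply: contraNneq (mulf_neq0 f0 d0) => n0; rewrite e n0 mulr0.
have := congr1 (@fps_ord k) e; rewrite !fps_ordM // => /(congr1 Posz).
rewrite !PoszD => e'; apply/eqP; rewrite subr_eq addrAC eq_sym subr_eq e'.
by rewrite addrC.
Qed.

End Laurent.

Definition abs_inf (R : realType) (k : finFieldType) (x : laurent k) : R :=
  if x == 0 then 0 else #|k|%:R ^ (- val_inf x).

Section Matrices.
Variable k : finFieldType.
Local Notation K := (laurent k).
Implicit Types (g h : 'M[K]_2) (G H : set 'M[K]_2).

Definition GL2 : set 'M[K]_2 := [set g | g \in unitmx].

Definition is_subgroup G :=
  [/\ G `<=` GL2, G 1%:M, forall g h, G g -> G h -> G (g *m h) &
      forall g, G g -> G (invmx g)].

(** The topology of [GL2 (K)] is the one induced by [K ^ 4]: every point of [G]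
    is isolated in [G]. *)
Definition discrete (R : realType) G :=
  forall g, G g -> exists2 e : R, 0 < e &
    forall h, G h -> (forall i j, abs_inf R (h i j - g i j) < e) -> h = g.

Definition rcoset H g : set 'M[K]_2 := [set h *m g | h in H].

Definition rcosets H G : set (set 'M[K]_2) := [set rcoset H g | g in G].

Definition commensurable G H :=
  finite_set (rcosets (G `&` H) G) /\ finite_set (rcosets (G `&` H) H).

Definition GL2A : set 'M[K]_2 :=
  [set map_mx (@poly_inf k) M | M in [set M : 'M[{poly k}]_2 | M \in unitmx]].

Definition generated g : set 'M[K]_2 := [set g ^ n | n in [set: int]].

(** The eigenvalues live in an algebraic closure [C] of [K], to which the
    absolute value of [K] extends uniquely; hence any choice of [C] and of
    [absC] gives the same condition. *)
Definition is_abs_extension (R : realType) (C : fieldType)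
    (iota : K -> C) (absC : C -> R) :=
  [/\ forall x, 0 <= absC x, forall x, absC x = 0 <-> x = 0,
      forall x y, absC (x * y) = absC x * absC y,
      forall x y, absC (x + y) <= Num.max (absC x) (absC y) &
      forall x, absC (iota x) = abs_inf R x].

Definition hyperbolic (R : realType) g :=
  g \in unitmx /\
  exists (C : closedFieldType) (iota : {rmorphism K -> C}) (absC : C -> R),
    [/\ forall z, algebraicOver iota z,
        is_abs_extension iota absC &
        exists l1 l2 : C,
          map_poly iota (char_poly g) = ('X - l1%:P) * ('X - l2%:P) /\
          absC l1 <> absC l2].

(** The projective line, [None] being the point at infinity. *)
Definition P1 := option K.

Definition mobius g (z : P1) : P1 :=
  match z with
  | Some x =>
      if g 1 0 * x + g 1 1 == 0 then None
      else Some ((g 0 0 * x + g 0 1) / (g 1 0 * x + g 1 1))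
  | None => if g 1 0 == 0 then None else Some (g 0 0 / g 1 0)
  end.

Definition fixed_points g : set P1 := [set z | mobius g z = z].

Definition P1F : set P1 :=
  [set z | if z is Some x then @ratfun_inf k x else True].

End Matrices.

Section Tree.
Variable k : finFieldType.
Local Notation K := (laurent k).
Local Notation O := (@Oinf k).
Local Notation pi := (@piinf k).
Implicit Types (L : set 'rV[K]_2) (g : 'M[K]_2).

Definition is_lattice L := exists2 B : 'M[K]_2, B \in unitmx &
  L = [set c *m B | c in [set c : 'rV[K]_2 | forall j, O (c 0 j)]].

Definition scale_set (x : K) L : set 'rV[K]_2 := [set x *: u | u in L].

Definition homothety_class L : set (set 'rV[K]_2) :=
  [set scale_set x L | x in [set x | x != 0]].

(** A vertex is a homothety class, taken as a set of lattices; being a vertex is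
    expressed by membership in [vertices]. *)
Definition vtx := set (set 'rV[K]_2).

Definition vertices : set vtx := [set homothety_class L | L in is_lattice].

Definition adjacent (v w : vtx) :=
  [/\ vertices v, vertices w & exists L L',
    [/\ v L, w L', scale_set pi L `<` L' & L' `<` L]].

Definition act g (v : vtx) : vtx :=
  [set [set u *m invmx g | u in L] | L in v].

Definition std_vertex (n : int) : vtx :=
  homothety_class [set (pi ^ n * x) *: 'e_0 + y *: 'e_1 | x in O & y in O].

Definition half_line (x : nat -> vtx) :=
  forall n, adjacent (x n) (x n.+1) /\ x n <> x n.+2.

Definition same_end (x y : nat -> vtx) :=
  exists m n, forall i, x (m + i)%N = y (n + i)%N.

(** The half-line [x] represents the end identified with [a]. The identification
    is determined by equivariance and by its value at infinity, since [GL2] acts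
    transitively on [P1] and the stabilizer of infinity (upper triangular
    matrices) fixes the end of [(std_vertex n)_n>=0]. The matrix exchanging the
    coordinates sends [std_vertex n] to [std_vertex (- n)] and infinity to 0,
    so [(std_vertex (- n))_n>=0] represents 0. *)
Definition represents (x : nat -> vtx) (a : P1 k) :=
  half_line x /\ exists2 g, g \in unitmx &
    mobius g None = a /\ same_end x (fun n => act g (std_vertex n%:Z)).

Definition is_geodesic (a b : P1 k) (x : int -> vtx) :=
  [/\ forall n, adjacent (x n) (x (n + 1)) /\ x n <> x (n + 2),
      represents (fun n => x (- n%:Z)) a & represents (fun n => x n%:Z) b].

Definition geodesic (a b : P1 k) : set vtx :=
  [set v | exists2 x, is_geodesic a b x & range x v].

Definition walk_lengths (v w : vtx) : set nat :=
  [set n | exists x : nat -> vtx, [/\ x 0%N = v, x n = w &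
    forall i, (i < n)%N -> adjacent (x i) (x i.+1)]].

Definition dist (R : realType) (v w : vtx) : \bar R :=
  ereal_inf [set n%:R%:E | n in walk_lengths v w].

Definition dist_to (R : realType) (v : vtx) (S : set vtx) : \bar R :=
  ereal_inf [set dist R v w | w in S].

(** [S_N(v)], as a set of right cosets of [H] in [G]. *)
Definition near_cosets (R : realType) (G H : set 'M[K]_2) (r : nat)
    (a b : 'I_r -> P1 k) (N : nat) (v : vtx) : set (set 'M[K]_2) :=
  [set rcoset H g | g in [set g | G g /\
    forall i, (dist_to R (act g v) (geodesic (a i) (b i)) <= N%:R%:E)%E]].

Definition propP_some (R : realType) (G H : set 'M[K]_2) (r : nat)
    (a b : 'I_r -> P1 k) :=
  exists2 v, vertices v & forall N, finite_set (near_cosets R G H a b N v).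

Definition propP_all (R : realType) (G H : set 'M[K]_2) (r : nat)
    (a b : 'I_r -> P1 k) :=
  forall v, vertices v -> forall N, finite_set (near_cosets R G H a b N v).

End Tree.

(* Main.v *)
(** For [a] in [P^1] let [l_a] be a row vector whose kernel, as a form on column
    vectors, is the line [a], and let [u_a(g) = |l_a g|] in the sup norm. The
    function [L |-> |l_a|_L |l_b|_L / covol(L)] on lattices is invariant under
    homothety, is multiplied by at most [q] along an edge of the tree, and is
    constant on the geodesic [[a -> b]], whose vertices are the classes
    [[x O l_b + y O l_a]]. At [g v_0], with [det g] a unit, its value is
    [u_a(g) u_b(g)], so [d(g v_0, [a -> b]) <= N] bounds [u_a(g) u_b(g)].

    By discreteness, only finitely many elements of [Gamma] have bounded
    entries, so each case reduces to bounding [g]. If two forms with different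
    kernels are bounded at [g], so is [g]. Hence the bounds on the products
    [u_{a_i}(g) u_{b_i}(g)] bound [g] unless the small factors all belong to one
    common end [p] of the geodesics, and also then if [u_p] is bounded below on
    [Gamma]. This holds when [p] is rational and [Gamma] is commensurable with
    [GL_2(A)], because nonzero vectors of [A^2] have norm at least 1. In the
    hyperbolic case multiplication by a power of [delta], which scales [u_a]
    by a fixed factor of absolute value different from 1 and preserves
    [u_a u_b], makes both factors bounded.

    The vertices of a geodesic are found without using that the tree is simply
    connected: relative to an end, every neighbour of a vertex other than its
    parent is a child, so a path without backtracking that starts from the end
    goes from parent to child forever. *)
Require Import Defs.
From HB Require Import structures.
From mathcomp Require Import all_boot all_order all_algebra.
From mathcomp Require Import all_classical all_reals ereal.
From mathcomp Require Import ring zify.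

Set Implicit Arguments.
Unset Strict Implicit.
Unset Printing Implicit Defensive.

Import Order.TTheory GRing.Theory Num.Theory.
Local Open Scope classical_set_scope.
Local Open Scope ring_scope.

(** * Ultrametric absolute values *)

(** The ultrametric inequality is stated through a common bound [C], so that it applies directly to
    a goal. By [av_expz] the value group is cyclic, generated by the value of the uniformizer
    [unif]. *)
Record absolute_value (R : realType) (K : fieldType) := AbsoluteValue {
  av :> K -> R;
  unif : K;
  av0 : av 0 = 0;
  av_gt0 : forall x, (0 < av x) = (x != 0);
  avM : forall x y, av (x * y) = av x * av y;
  avD : forall x y C, av x <= C -> av y <= C -> av (x + y) <= C;
  unif_lt1 : av unif < 1;
  av_expz : forall x, x != 0 -> exists n : int, av x = av unif ^ n;
  unif_neq0 : unif != 0
}.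

Arguments av : simpl never.
Arguments unif : simpl never.

Section UltrametricField.
Variables (R : realType) (K : fieldType) (abs : absolute_value R K).
Local Notation pi := (unif abs).
Implicit Types (x y : K) (C : R).

Lemma av_eq0 x : (abs x == 0) = (x == 0).
Proof.
apply/eqP/eqP => [x0|->]; last exact: av0.
by apply/eqP/negPn; rewrite -(av_gt0 abs) x0 ltxx.
Qed.

Lemma av_ge0 x : 0 <= abs x.
Proof. by rewrite le_eqVlt av_gt0 eq_sym av_eq0 orbN. Qed.

Lemma av1 : abs 1 = 1.
Proof.
have := avM abs 1 1; rewrite mulr1 => /esym/eqP; rewrite -subr_eq0 -{3}(mulr1 (abs 1)) -mulrBr.
by rewrite mulf_eq0 av_eq0 oner_eq0 /= subr_eq0 => /eqP.
Qed.

Lemma avV x : abs x^-1 = (abs x)^-1.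
Proof.
have [->|x0] := eqVneq x 0; first by rewrite invr0 av0 invr0.
have ax : abs x != 0 by rewrite av_eq0.
by apply: (mulfI ax); rewrite -avM !mulfV // av1.
Qed.

Lemma avN x : abs (- x) = abs x.
Proof.
have /eqP : abs (-1) ^+ 2 = 1 by rewrite expr2 -avM mulrNN mulr1 av1.
rewrite sqrf_eq1 => /orP[] /eqP e; first by rewrite -mulN1r avM e mul1r.
by have := av_ge0 (-1); rewrite e oppr_ge0 ler10.
Qed.

Lemma avB x y C : abs x <= C -> abs y <= C -> abs (x - y) <= C.
Proof. by move=> xC yC; apply: avD; rewrite ?avN. Qed.

(** Otherwise [x = (x + y) - y] would be a difference of two elements of smaller absolute value. *)
Lemma avD_lt x y : abs y < abs x -> abs (x + y) = abs x.
Proof.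
move=> yx; apply/eqP; rewrite eq_le avD ?(ltW yx) //= leNgt; apply/negP => xyx.
have : abs (x + y - y) <= Num.max (abs (x + y)) (abs y).
  by apply: avB; rewrite le_max lexx ?orbT.
by rewrite addrK leNgt gt_max xyx yx.
Qed.

Lemma avXz x (n : int) : abs (x ^ n) = abs x ^ n.
Proof.
have H m : abs (x ^+ m) = abs x ^+ m.
  by elim: m => [|m IH]; rewrite ?expr0 ?av1 // !exprS avM IH.
by case: n => n; rewrite ?NegzE -?exprnP -?exprnN ?avV H.
Qed.

Lemma avX x n : abs (x ^+ n) = abs x ^+ n.
Proof. exact: (avXz x n%:Z). Qed.

Lemma unif_gt0 : 0 < abs pi. Proof. by rewrite av_gt0 unif_neq0. Qed.

Lemma unif_expz_le (m n : int) : (abs pi ^ m <= abs pi ^ n) = (n <= m).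
Proof.
have p1 : 1 < (abs pi)^-1 by rewrite invf_gt1 ?unif_gt0 ?unif_lt1.
have E l : abs pi ^ l = (abs pi)^-1 ^ (- l) by rewrite exprz_inv opprK.
by rewrite !E ler_eXz2l // lerN2.
Qed.

Lemma unif_expz_lt (m n : int) : (abs pi ^ m < abs pi ^ n) = (n < m).
Proof. by rewrite !ltNge unif_expz_le. Qed.

(** Nonzero values are powers of [abs pi], so none lies strictly between [abs pi] and 1. *)
Lemma av_lt1 x : abs x < 1 -> abs x <= abs pi.
Proof.
have [->|/(av_expz abs)[n ->]] := eqVneq x 0; first by rewrite av0 (ltW unif_gt0).
rewrite -{3}(expr1z (abs pi)) -(expr0z (abs pi)) unif_expz_lt unif_expz_le; lia.
Qed.

Lemma av_sum_lt n (F : nat -> K) C : 0 < C -> (forall i, (i < n)%N -> abs (F i) < C) ->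
  abs (\sum_(i < n) F i) < C.
Proof.
move=> C0 FC; elim/big_rec : _ => [|i x _ xC]; first by rewrite av0.
apply: le_lt_trans (@avD _ _ abs _ _ (Num.max (abs (F i)) (abs x)) _ _) _.
- by rewrite le_max lexx.
- by rewrite le_max lexx orbT.
- by rewrite gt_max xC FC.
Qed.

End UltrametricField.

(** * Two by two matrices *)

Definition rv2 (T : Type) (a b : T) : 'rV[T]_2 := \row_j if j == 0 then a else b.

Section TwoByTwo.
Variable F : fieldType.
Implicit Types (a b c d x : F) (M N : 'M[F]_2).

Definition mx2 a b c d : 'M[F]_2 :=
  \matrix_(i, j) if i == 0 then if j == 0 then a else b else if j == 0 then c else d.

(** An eliminator whose cases are the literals [0] and [1], so that the tests [i == 0] in [mx2] and
    [rv2] then compute. *)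
Lemma ord2E (P : 'I_2 -> Prop) : P 0 -> P 1 -> forall i, P i.
Proof.
by move=> P0 P1 i; case: i => -[|[|//]] lt;
  [move: P0|move: P1]; congr P; apply: val_inj.
Qed.

Lemma sum2 (f : 'I_2 -> F) : \sum_i f i = f 0 + f 1.
Proof. by rewrite !big_ord_recl big_ord0 addr0; congr (_ + f _); apply: val_inj. Qed.

Lemma mx2_eta M : M = mx2 (M 0 0) (M 0 1) (M 1 0) (M 1 1).
Proof. by apply/matrixP; elim/ord2E; elim/ord2E; rewrite mxE. Qed.

Lemma rv2_eta (u : 'rV[F]_2) : u = rv2 (u 0 0) (u 0 1).
Proof. by apply/rowP; elim/ord2E; rewrite mxE. Qed.

Lemma mx2M a b c d a' b' c' d' : mx2 a b c d *m mx2 a' b' c' d' =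
  mx2 (a * a' + b * c') (a * b' + b * d') (c * a' + d * c') (c * b' + d * d').
Proof. by apply/matrixP; elim/ord2E; elim/ord2E; rewrite !mxE sum2 !mxE. Qed.

Lemma rv2M a b a' b' c' d' : rv2 a b *m mx2 a' b' c' d' =
  rv2 (a * a' + b * c') (a * b' + b * d').
Proof. by apply/rowP; elim/ord2E; rewrite !mxE sum2 !mxE. Qed.

Lemma mx2Z x a b c d : x *: mx2 a b c d = mx2 (x * a) (x * b) (x * c) (x * d).
Proof. by apply/matrixP; elim/ord2E; elim/ord2E; rewrite !mxE. Qed.

Lemma rv2Z x a b : x *: rv2 a b = rv2 (x * a) (x * b).
Proof. by apply/rowP; elim/ord2E; rewrite !mxE. Qed.

Lemma mx2_scalar x : x%:M = mx2 x 0 0 x.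
Proof. by apply/matrixP; elim/ord2E; elim/ord2E; rewrite !mxE. Qed.

Lemma det_mx2 M : \det M = M 0 0 * M 1 1 - M 0 1 * M 1 0.
Proof.
rewrite (expand_det_row M 0) sum2 /cofactor !det_mx11 !mxE /=.
rewrite addn0 addn1 expr0 expr1 mul1r mulN1r mulrN.
by congr (_ * M _ _ - _ * M _ _); apply: val_inj.
Qed.

Lemma invmx2 M : M \in unitmx ->
  invmx M = (\det M)^-1 *: mx2 (M 1 1) (- M 0 1) (- M 1 0) (M 0 0).
Proof.
move=> Mu; have d0 : \det M != 0 by rewrite -unitfE -unitmxE.
apply: (can_inj (mulKmx Mu)); rewrite mulmxV // -scalemxAr [X in X *m _]mx2_eta mx2M mx2Z.
by rewrite mx2_scalar det_mx2 in d0 *; congr mx2; field.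
Qed.

Lemma unitmx_det M : (M \in unitmx) = (\det M != 0).
Proof. by rewrite unitmxE unitfE. Qed.

Lemma unitmx_scale x M : x != 0 -> M \in unitmx -> x *: M \in unitmx.
Proof. by rewrite !unitmx_det detZ => x0 M0; rewrite mulf_neq0 ?expf_neq0. Qed.

Lemma invmx_scale x M : x != 0 -> M \in unitmx -> invmx (x *: M) = x^-1 *: invmx M.
Proof. by move=> x0 Mu; rewrite invmxZ // unitmx_scale. Qed.

Lemma invmx_mul M N : M \in unitmx -> N \in unitmx ->
  invmx (M *m N) = invmx N *m invmx M.
Proof.
move=> Mu Nu; have MNu : M *m N \in unitmx by rewrite unitmx_mul Mu.
apply: (can_inj (mulKmx MNu)); rewrite mulmxV //.
by rewrite mulmxA -(mulmxA M) mulmxV // mulmx1 mulmxV.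
Qed.

End TwoByTwo.

(** * Norms of row vectors and matrices, and integral invertible matrices *)

Section Norms.
Variables (R : realType) (K : fieldType) (abs : absolute_value R K).
Local Notation pi := (unif abs).

Implicit Types (u : 'rV[K]_2) (M N U V : 'M[K]_2) (x y : K) (C D : R).

Definition rnorm (u : 'rV[K]_2) : R := Num.max (abs (u 0 0)) (abs (u 0 1)).

Definition bounded (C : R) (M : 'M[K]_2) := forall i j, abs (M i j) <= C.

Lemma rnorm_le u C : (rnorm u <= C) = (abs (u 0 0) <= C) && (abs (u 0 1) <= C).
Proof. exact: ge_max. Qed.

Lemma rnorm_ge0 u : 0 <= rnorm u.
Proof. by rewrite le_max av_ge0. Qed.

Lemma rnorm_gt0 u : (0 < rnorm u) = (u != 0).
Proof.
rewrite lt_neqAle rnorm_ge0 andbT eq_sym; congr (~~ _).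
apply/eqP/eqP => [u0|->]; last by rewrite /rnorm !mxE av0 maxxx.
have := lexx (rnorm u); rewrite {2}u0 rnorm_le !le_eqVlt !av_eq0.
rewrite !(ltNge _ 0) !av_ge0 !orbF => /andP[/eqP u00 /eqP u01].
by apply/rowP; elim/ord2E; rewrite mxE.
Qed.

Lemma rnormZ x u : rnorm (x *: u) = abs x * rnorm u.
Proof. by rewrite /rnorm !mxE !avM maxr_pMr ?av_ge0. Qed.

Lemma abs_rnorm u j : abs (u 0 j) <= rnorm u.
Proof. by elim/ord2E : j; rewrite le_max lexx ?orbT. Qed.

Lemma rnorm_exists_expz u : u != 0 -> exists n : int, rnorm u = abs pi ^ n.
Proof.
rewrite -rnorm_gt0 /rnorm; case: (leP (abs (u 0 0))) => _; rewrite av_gt0; exact: av_expz.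
Qed.

Lemma rnormM u M C : bounded C M -> rnorm (u *m M) <= rnorm u * C.
Proof.
move=> MC; rewrite rnorm_le !mxE !sum2.
by apply/andP; split; apply: avD; rewrite avM; apply: ler_pM;
  rewrite ?av_ge0 // ?abs_rnorm //; exact: MC.
Qed.

Lemma bounded_ge0 C M : bounded C M -> 0 <= C.
Proof. by move=> /(_ 0 0); apply: le_trans; exact: av_ge0. Qed.

Lemma boundedW C D M : C <= D -> bounded C M -> bounded D M.
Proof. by move=> CD MC i j; exact: le_trans (MC i j) CD. Qed.

Lemma bounded_mx2 C a b c d : abs a <= C -> abs b <= C -> abs c <= C -> abs d <= C ->
  bounded C (mx2 a b c d).
Proof. by move=> ? ? ? ?; elim/ord2E; elim/ord2E; rewrite mxE. Qed.

Lemma bounded_ex M : exists2 C, 0 < C & bounded C M.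
Proof.
exists (1 + \sum_i \sum_j abs (M i j)).
  by rewrite ltr_pwDl // sumr_ge0 // => i _; rewrite sumr_ge0 // => j _; exact: av_ge0.
have le_sum (f : 'I_2 -> R) i : (forall j, 0 <= f j) -> f i <= \sum_j f j.
  by move=> f0; rewrite (bigD1 i) //= lerDl sumr_ge0.
move=> i j; apply: le_trans (le_sum (fun j => abs (M i j)) j _) _.
- by move=> ?; exact: av_ge0.
- apply: le_trans (le_sum (fun i => \sum_j abs (M i j)) i _) _.
    by move=> ?; rewrite sumr_ge0 // => ? _; exact: av_ge0.
  by rewrite lerDr.
Qed.

Lemma boundedM C D M N : bounded C M -> bounded D N -> bounded (C * D) (M *m N).
Proof.
move=> MC ND i j; have C0 := bounded_ge0 MC; have D0 := bounded_ge0 ND.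
by rewrite !mxE sum2; apply: avD; rewrite avM; apply: ler_pM;
  rewrite ?av_ge0.
Qed.

Lemma bounded1M M N : bounded 1 M -> bounded 1 N -> bounded 1 (M *m N).
Proof. by move=> M1 N1; rewrite -[1]mulr1; exact: boundedM. Qed.

Lemma bounded_det C M : bounded C M -> abs (\det M) <= C ^+ 2.
Proof.
move=> MC; rewrite det_mx2 expr2.
by apply: avB; rewrite avM; apply: ler_pM; rewrite ?av_ge0.
Qed.

Lemma bounded_invmx C M : M \in unitmx -> bounded C M -> bounded (C / abs (\det M)) (invmx M).
Proof.
move=> Mu MC i j; rewrite invmx2 // mxE avM avV mulrC ler_wpM2r ?invr_ge0 ?av_ge0 //.
by apply: bounded_mx2; rewrite ?avN.
Qed.

(** [GL_2] of the ring of integers. *)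
Definition GLO (U : 'M[K]_2) := bounded 1 U /\ abs (\det U) = 1.

Lemma GLO_unit U : GLO U -> U \in unitmx.
Proof. by case=> _ dU; rewrite unitmx_det -(av_gt0 abs) dU ltr01. Qed.

(** The determinants of [U] and of its inverse both have value at most 1, and their product is 1. *)
Lemma GLO_intro U : U \in unitmx -> bounded 1 U -> bounded 1 (invmx U) -> GLO U.
Proof.
move=> Uu U1 V1; split; first exact: U1.
move: (bounded_det U1) (bounded_det V1); rewrite det_inv avV expr1n => le1.
rewrite invf_le1; last by rewrite av_gt0 -unitmx_det.
by move=> ge1; apply/eqP; rewrite eq_le le1.
Qed.

Lemma GLO_inv U : GLO U -> GLO (invmx U).
Proof.
move=> UO; have Uu := GLO_unit UO; case: UO => U1 dU; split.
  by have := bounded_invmx Uu U1; rewrite dU divr1.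
by rewrite det_inv avV dU invr1.
Qed.

Lemma GLO_mul U V : GLO U -> GLO V -> GLO (U *m V).
Proof.
by move=> [U1 dU] [V1 dV]; split; [exact: bounded1M|rewrite det_mulmx avM dU dV mulr1].
Qed.

Lemma GLO1 : GLO 1%:M.
Proof.
split; last by rewrite det1 av1.
by rewrite mx2_scalar; apply: bounded_mx2; rewrite ?av0 ?av1 ?ler01.
Qed.

End Norms.

(** * Elementary steps between lattices *)

Section ElementarySteps.
Variables (R : realType) (K : fieldType) (abs : absolute_value R K).
Local Notation pi := (unif abs).
Local Notation bounded := (bounded abs).
Local Notation GLO := (GLO abs).
Implicit Types (B M S T U V : 'M[K]_2) (x y : K).

(** Let [L] and [L'] be spanned by the rows of [B] and [M *m B]. The bounds say that pi L is in L'
    and L' in L; the determinant makes both inclusions strict. *)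
Definition elementary_step M :=
  [/\ bounded 1 M, bounded 1 (pi *: invmx M) & abs (\det M) = abs pi].

Lemma elementary_step_unit M : elementary_step M -> M \in unitmx.
Proof. by case=> _ _ dM; rewrite unitmx_det -(av_gt0 abs) dM unif_gt0. Qed.

(** If [M] is not invertible over the integers, discreteness gives |det M| <= |pi|. The same
    argument for [pi *: invmx M], whose determinant has value |pi|^2 / |det M|, gives the opposite
    inequality. *)
Lemma elementary_step_intro M : M \in unitmx -> bounded 1 M -> bounded 1 (pi *: invmx M) ->
  ~ bounded 1 (invmx M) -> ~ bounded 1 (pi^-1 *: M) -> elementary_step M.
Proof.
move=> Mu M1 N1 n1 n2; split; [exact: M1|exact: N1|].
have p0 := unif_gt0 abs.
have d0 : 0 < abs (\det M) by rewrite av_gt0 -unitmx_det.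
apply/eqP; rewrite eq_le; apply/andP; split.
  apply: av_lt1; rewrite lt_neqAle; have := bounded_det M1; rewrite expr1n => ->; rewrite andbT.
  by apply/eqP => d1; apply: n1; have := bounded_invmx Mu M1; rewrite d1 divr1.
have Nu : pi *: invmx M \in unitmx by rewrite unitmx_scale ?unif_neq0 ?unitmx_inv.
have dN : abs (\det (pi *: invmx M)) = abs pi ^+ 2 / abs (\det M).
  by rewrite detZ det_inv avM avV !expr2 avM.
suff : abs (\det (pi *: invmx M)) <= abs pi.
  by rewrite dN ler_pdivrMr // expr2 ler_pM2l.
apply: av_lt1; rewrite lt_neqAle; have := bounded_det N1; rewrite expr1n => ->; rewrite andbT.
apply/eqP => d1; apply: n2.
have := bounded_invmx Nu N1; rewrite d1 divr1 invmx_scale ?unif_neq0 ?unitmx_inv //.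
by rewrite invmxK.
Qed.

(** Both matrices have determinant of value 1 / |pi| > 1, which no integral matrix has. *)
Lemma elementary_step_strict M : elementary_step M ->
  ~ bounded 1 (invmx M) /\ ~ bounded 1 (pi^-1 *: M).
Proof.
case=> _ _ dM; have [p0 p1] := (unif_gt0 abs, unif_lt1 abs).
split=> /bounded_det; rewrite expr1n.
  by rewrite det_inv avV dM invf_le1 // leNgt p1.
rewrite detZ avM avX avV dM exprVn expr2 invfM mulrVK ?unitf_gt0 //.
by rewrite invf_le1 // leNgt p1.
Qed.

Lemma elementary_step_quotient B B' : B \in unitmx -> B' \in unitmx ->
    bounded 1 (B' *m invmx B) -> bounded 1 (pi *: (B *m invmx B')) ->
    ~ bounded 1 (B *m invmx B') -> ~ bounded 1 (pi^-1 *: (B' *m invmx B)) ->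
  exists2 M, elementary_step M & B' = M *m B.
Proof.
move=> Bu B'u M1 V1 n1 n2; exists (B' *m invmx B); last by rewrite mulmxKV.
have E : invmx (B' *m invmx B) = B *m invmx B' by rewrite invmx_mul ?unitmx_inv // invmxK.
by apply: elementary_step_intro; rewrite ?E // unitmx_mul B'u unitmx_inv.
Qed.

Lemma GLO_quotient B B' : B \in unitmx -> B' \in unitmx ->
  bounded 1 (B' *m invmx B) -> bounded 1 (B *m invmx B') -> exists2 U, GLO U & B' = U *m B.
Proof.
move=> Bu B'u U1 V1; exists (B' *m invmx B); last by rewrite mulmxKV.
apply: GLO_intro => //; first by rewrite unitmx_mul B'u unitmx_inv.
by rewrite invmx_mul ?unitmx_inv // invmxK.
Qed.

Lemma elementary_step_mulr M U : elementary_step M -> GLO U -> elementary_step (M *m U).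
Proof.
move=> Ms UO; have Mu := elementary_step_unit Ms; have Uu := GLO_unit UO.
have [V1 _] := GLO_inv UO; case: Ms UO => M1 N1 dM [U1 dU]; split.
- exact: bounded1M.
- by rewrite invmx_mul // scalemxAr; apply: bounded1M.
- by rewrite det_mulmx avM dM dU mulr1.
Qed.

(** The reverse step goes from L' to pi L, which is homothetic to L. *)
Lemma elementary_step_sym M : elementary_step M -> elementary_step (pi *: invmx M).
Proof.
move=> Ms; have Mu := elementary_step_unit Ms; case: Ms => M1 N1 dM.
have p0 := unif_neq0 abs; have ap0 : abs pi != 0 by rewrite av_eq0.
split; first exact: N1.
  by rewrite invmx_scale ?unitmx_inv // invmxK scalerA mulfV // scale1r.
by rewrite detZ avM avX det_inv avV dM expr2 mulfK.
Qed.

Definition upper T := T \in unitmx /\ T 1 0 = 0.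

Lemma upper_mx2 T : upper T ->
  [/\ T = mx2 (T 0 0) (T 0 1) 0 (T 1 1), T 0 0 != 0 & T 1 1 != 0].
Proof.
case; rewrite unitmx_det det_mx2 => + T10; rewrite T10 mulr0 subr0 mulf_eq0 negb_or.
by case/andP; split => //; rewrite [LHS]mx2_eta T10.
Qed.

Lemma mx2_upper x y z : x != 0 -> z != 0 -> upper (mx2 x y 0 z).
Proof.
by move=> x0 z0; rewrite /upper unitmx_det det_mx2 !mxE mulr0 subr0 mulf_neq0.
Qed.

Lemma upper_mul S T : upper S -> upper T -> upper (S *m T).
Proof.
move=> /upper_mx2[SE s0 s1] /upper_mx2[TE t0 t1].
by rewrite SE TE mx2M !(mulr0, mul0r, add0r, addr0); apply: mx2_upper; rewrite mulf_neq0.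
Qed.

Lemma upper_inv T : upper T -> upper (invmx T).
Proof.
move=> [Tu T10]; split; first by rewrite unitmx_inv.
by rewrite invmx2 // !mxE /= T10 oppr0 mulr0.
Qed.

Lemma GLO_mx2 a b c d : abs a <= 1 -> abs b <= 1 -> abs c <= 1 -> abs d <= 1 ->
  abs (a * d - b * c) = 1 -> GLO (mx2 a b c d).
Proof. by move=> *; split; [exact: bounded_mx2|rewrite det_mx2 !mxE]. Qed.

(** Row reduction of the first column, taking its larger entry as pivot so that the multiplier is
    integral. *)
Lemma iwasawa M : M \in unitmx -> exists U S, [/\ GLO U, upper S & M = U *m S].
Proof.
move=> Mu.
suff [U [UO UM]] : exists U, GLO U /\ (U *m M) 1 0 = 0.
  exists (invmx U), (U *m M); split; [exact: GLO_inv| |by rewrite (mulKmx (GLO_unit UO))].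
  by rewrite /upper unitmx_mul (GLO_unit UO).
have [le|lt] := leP (abs (M 1 0)) (abs (M 0 0)).
  have a0 : M 0 0 != 0.
    apply: contraTneq Mu => a0; rewrite unitmx_det det_mx2 a0 mul0r sub0r negbK.
    by move: le; rewrite a0 av0 le_eqVlt ltNge av_ge0 orbF av_eq0 => /eqP ->; rewrite mulr0 oppr0.
  exists (mx2 1 0 (- (M 1 0 / M 0 0)) 1); split.
    apply: GLO_mx2; rewrite ?av0 ?av1 ?avN ?ler01 //.
      by rewrite avM avV ler_pdivrMr ?av_gt0 // mul1r.
    by rewrite mul1r mul0r subr0 av1.
  by rewrite [X in _ *m X]mx2_eta mx2M mxE /= mulNr divfK // mul1r addNr.
have c0 : M 1 0 != 0 by rewrite -(av_gt0 abs); apply: le_lt_trans lt; exact: av_ge0.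
exists (mx2 0 1 1 (- (M 0 0 / M 1 0))); split.
  apply: GLO_mx2; rewrite ?av0 ?av1 ?avN ?ler01 //.
    by rewrite avM avV ler_pdivrMr ?av_gt0 // mul1r ltW.
  by rewrite mul1r mul0r sub0r avN av1.
by rewrite [X in _ *m X]mx2_eta mx2M mxE /= mulNr divfK // mul1r subrr.
Qed.

Definition pi_step : 'M[K]_2 := mx2 pi 0 0 1.

Lemma pi_stepP : elementary_step pi_step.
Proof.
have p0 := unif_neq0 abs; have p1 := ltW (unif_lt1 abs).
have d : \det pi_step = pi by rewrite det_mx2 !mxE /= mulr1 mulr0 subr0.
split; last by rewrite d.
  by apply: bounded_mx2; rewrite ?av0 ?av1 ?ler01.
rewrite invmx2 ?unitmx_det d // scalerA mulfV // scale1r !mxE /= oppr0.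
by apply: bounded_mx2; rewrite ?av0 ?av1 ?ler01.
Qed.

(** The neighbours of [T] are its parent [pi_step *m T], which lies towards the
    end spanned by the second basis vector, and classes with parent [T]. *)
Lemma elementary_step_upper M T : elementary_step M -> upper T ->
  (exists2 U, GLO U & M *m T = U *m (pi_step *m T)) \/
  (exists U S, [/\ GLO U, upper S, M *m T = U *m S &
     exists x V, [/\ x != 0, GLO V & pi_step *m S = x *: (V *m T)]]).
Proof.
move=> Ms Tu; have Mu := elementary_step_unit Ms.
have [U [S [UO Su ME]]] := iwasawa Mu.
have Vs : bounded 1 (invmx U) by case: (GLO_inv UO).
have [M1 _ dM] := Ms.
have S1 : bounded 1 S by rewrite -(mulKmx (GLO_unit UO) S) -ME; exact: bounded1M.
have dS : abs (\det S) = abs pi.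
  by case: UO dM => _ dU; rewrite ME det_mulmx avM dU mul1r.
have [SE s0 s1] := upper_mx2 Su; have [p0 p1] := (unif_neq0 abs, unif_lt1 abs).
move: dS; rewrite det_mx2; case: (Su) => _ ->; rewrite mulr0 subr0 avM => dS.
(* The diagonal entries of [S] are integral with product of value |pi|, so exactly one is a unit. If
   it is [S 1 1], the neighbour is the parent of [T]; otherwise [T] is the parent of the
   neighbour. *)
have [dle|dgt] := leP (abs (S 1 1)) (abs pi); last first.
  have d1 : abs (S 1 1) = 1.
    apply/eqP; rewrite eq_le S1 /= leNgt; apply/negP => /av_lt1.
    by rewrite leNgt dgt.
  left; exists (U *m mx2 (S 0 0 / pi) (S 0 1) 0 (S 1 1)).
    apply: GLO_mul => //; apply: GLO_mx2; rewrite ?av0 ?ler01 //.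
      by rewrite avM avV ler_pdivrMr ?av_gt0 // mul1r -dS d1 mulr1.
    by rewrite mulr0 subr0 !avM d1 mulr1 avV -dS d1 mulr1 mulfV // av_eq0.
  rewrite ME {1}SE -!mulmxA; congr (_ *m _); rewrite [in RHS]mulmxA; congr (_ *m _).
  by rewrite mx2M !(mulr0, mul0r, add0r, addr0, mulr1) divfK.
have d1 : abs (S 0 0) = 1.
  apply/eqP; rewrite eq_le S1 /= -(ler_pM2r (unif_gt0 abs)) mul1r -{1}dS.
  by rewrite ler_pM2l // av_gt0.
have {}dS : abs (S 1 1) = abs pi by rewrite -dS d1 mul1r.
right; exists U, (S *m T); split => //; [exact: upper_mul|by rewrite ME mulmxA|].
exists (S 1 1), (mx2 (pi * S 0 0 / S 1 1) (pi * S 0 1 / S 1 1) 0 1); split => //.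
  apply: GLO_mx2; rewrite ?av0 ?av1 ?ler01 //.
  - by rewrite !avM avV dS d1 mulr1 mulfV // av_eq0.
  - by rewrite !avM avV dS mulrAC mulfV ?av_eq0 // mul1r.
  - by rewrite mulr0 subr0 mulr1 !avM avV dS d1 mulr1 mulfV // av_eq0.
rewrite mulmxA scalemxAl; congr (_ *m _).
rewrite {1}SE mx2M mx2Z !(mulr0, mul0r, add0r, addr0, mulr1, mul1r).
by congr mx2; rewrite [RHS]mulrC divfK.
Qed.

(** [U] is forced to be upper triangular. Conjugating its inverse by [pi_step] multiplies the corner
    entry by pi, so the result is still integral; it serves as [V]. Hence the parent of a diagonal
    class is diagonal. *)
Lemma pi_step_diag T x y z U : upper T -> x != 0 -> y != 0 -> z != 0 -> GLO U ->
    mx2 x 0 0 y = z *: (U *m T) ->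
  exists w V, [/\ w != 0, GLO V & pi_step *m T = w *: (V *m mx2 (pi * x) 0 0 y)].
Proof.
move=> Tu x0 y0 z0 UO e; have [TE t0 t1] := upper_mx2 Tu.
have U10 : U 1 0 = 0.
  have := congr1 (fun M : 'M_2 => M 1 0) e.
  rewrite TE [U]mx2_eta mx2M mx2Z !mxE /= mulr0 addr0 => /esym/eqP.
  by rewrite !mulf_eq0 (negPf z0) (negPf t0) orbF => /eqP.
have Uu : upper U by split; [exact: GLO_unit UO|exact: U10].
have [UE u0 u1] := upper_mx2 Uu; have [U1 dU] := UO.
have {}dU : abs (U 0 0) * abs (U 1 1) = 1.
  by rewrite -avM -dU det_mx2 U10 mulr0 subr0.
have u00 : abs (U 0 0) = 1.
  apply/eqP; rewrite eq_le U1 /= -dU ler_piMr ?av_ge0 //; exact: U1.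
have u11 : abs (U 1 1) = 1 by rewrite -dU u00 mul1r.
exists z^-1, (mx2 (U 0 0)^-1 (- (pi * U 0 1 / (U 0 0 * U 1 1))) 0 (U 1 1)^-1).
have [p0 p1] := (unif_neq0 abs, unif_lt1 abs).
split; first by rewrite invr_eq0.
  apply: GLO_mx2; rewrite ?avV ?av0 ?u00 ?u11 ?invr1 ?ler01 //.
    by rewrite avN !avM avV avM u00 u11 mulr1 invr1 mulr1 mulr_ile1 ?av_ge0 // ltW.
  by rewrite mulr0 subr0 avM !avV u00 u11 !invr1 mulr1.
have TE' : T = mx2 (x / (z * U 0 0)) (- (U 0 1 * y) / (z * U 0 0 * U 1 1)) 0 (y / (z * U 1 1)).
  move: e; rewrite TE UE mx2M mx2Z.
  rewrite !(mulr0, mul0r, add0r, addr0, mulr1, mul1r) => e.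
  have E i j := congr1 (fun M : 'M_2 => M i j) e.
  have := E 0 0; have := E 0 1; have := E 1 1; rewrite !mxE /= => -> e01 ->.
  congr mx2; try by field; rewrite ?z0 ?u0 ?u1.
  have {}e01 : U 0 0 * T 0 1 = - (U 0 1 * T 1 1).
    by apply/eqP; rewrite -addr_eq0; move/esym/eqP: e01; rewrite mulf_eq0 (negPf z0).
  apply: (mulfI u0); rewrite e01; field; by rewrite ?z0 ?u0 ?u1.
rewrite TE' !mx2M mx2Z !(mulr0, mul0r, add0r, addr0, mulr1, mul1r).
congr mx2; by field; rewrite ?z0 ?u0 ?u1.
Qed.

Lemma av_expn_small x y : x != 0 -> exists n0, forall n, (n0 <= n)%N ->
  abs (pi ^+ n * y) <= abs x.
Proof.
move=> x0; have [->|y0] := eqVneq y 0.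
  by exists 0%N => n _; rewrite mulr0 av0 av_ge0.
have [m xE] := av_expz abs x0; have [m' yE] := av_expz abs y0.
exists `|m - m'|%N => n nle; rewrite avM avX xE yE exprnP -expfzDr ?av_eq0 ?unif_neq0 //.
rewrite unif_expz_le; lia.
Qed.

(** The rows of the product are (pi^n y, pi^n t) and (s, 0). Once |pi^n y| <= |s|, an integral
    multiple of the second row clears pi^n y, and exchanging the rows leaves a diagonal matrix. *)
Lemma diag_split y t s : t != 0 -> s != 0 -> exists n0, forall n, (n0 <= n)%N ->
  exists2 V, GLO V & mx2 (pi ^+ n) 0 0 1 *m mx2 y t s 0 = V *m mx2 s 0 0 (pi ^+ n * t).
Proof.
move=> t0 s0; have [n0 n0P] := av_expn_small y s0; exists n0 => n /n0P yn.
exists (mx2 (pi ^+ n * y / s) 1 1 0).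
  apply: GLO_mx2; rewrite ?av0 ?av1 ?ler01 //.
    by rewrite avM avV ler_pdivrMr ?av_gt0 // mul1r.
  by rewrite mulr0 sub0r mulr1 avN av1.
by rewrite !mx2M !(mulr0, mul0r, add0r, addr0, mulr1, mul1r) divfK.
Qed.

(** By [iwasawa] it remains to treat upper triangular matrices, which are products of a scalar, a
    unipotent and a diagonal matrix. This induction principle serves to prove the tree connected. *)
Lemma GL2_generated (P : 'M[K]_2 -> Prop) :
    (forall U, GLO U -> P U) -> (forall x, x != 0 -> P x%:M) -> P pi_step ->
    (forall A B, A \in unitmx -> B \in unitmx -> P A -> P B -> P (A *m B)) ->
    (forall A, A \in unitmx -> P A -> P (invmx A)) ->
  forall B, B \in unitmx -> P B.
Proof.
move=> PU Px Pd PM PV B Bu; have p0 := unif_neq0 abs.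
have du x : x != 0 -> mx2 x 0 0 1 \in unitmx.
  by move=> x0; rewrite unitmx_det det_mx2 !mxE /= mulr1 mulr0 subr0.
have tu x : mx2 1 x 0 1 \in unitmx.
  by rewrite unitmx_det det_mx2 !mxE /= mulr1 mulr0 subr0 oner_neq0.
have Pn n : P (mx2 (pi ^+ n) 0 0 1).
  elim: n => [|n IH].
    by apply: PU; apply: GLO_mx2; rewrite ?expr0 ?av1 ?av0 ?ler01 ?mulr1 ?mulr0 ?subr0 ?av1.
  have -> : mx2 (pi ^+ n.+1) 0 0 1 = pi_step *m mx2 (pi ^+ n) 0 0 1.
    by rewrite mx2M !(mulr0, mul0r, add0r, addr0, mulr1, mul1r) exprS.
  by apply: PM IH; rewrite ?du ?expf_neq0.
have PVn n : P (mx2 (pi ^- n) 0 0 1).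
  have -> : mx2 (pi ^- n) 0 0 1 = invmx (mx2 (pi ^+ n) 0 0 1).
    rewrite invmx2 ?du ?expf_neq0 // det_mx2 !mxE /= mx2Z mulr1 mulr0 subr0 oppr0 mulr1 mulr0.
    by rewrite mulVf // expf_neq0.
  by apply: PV; rewrite ?du ?expf_neq0.
have Pdiag x : x != 0 -> P (mx2 x 0 0 1).
  move=> x0; have [m xE] := av_expz abs x0.
  have uE : abs (x * pi ^ (- m)) = 1.
    by rewrite avM avXz xE -expfzDr ?av_eq0 // subrr.
  have -> : mx2 x 0 0 1 = mx2 (x * pi ^ (- m)) 0 0 1 *m mx2 (pi ^ m) 0 0 1.
    rewrite mx2M !(mulr0, mul0r, add0r, addr0, mulr1, mul1r) -mulrA -expfzDr // addNr.
    by rewrite expr0z mulr1.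
  apply: (PM); rewrite ?du ?expfz_neq0 ?mulf_neq0 ?expfz_neq0 //.
    by apply: PU; apply: GLO_mx2; rewrite ?uE ?av1 ?av0 ?ler01 ?mulr1 ?mulr0 ?subr0.
  by case: (m) => n; [exact: Pn|rewrite NegzE -exprnN; exact: PVn].
have Pt x : P (mx2 1 x 0 1).
  have [n0 /(_ n0 (leqnn _))] := av_expn_small x (oner_neq0 K); rewrite av1 => le1.
  (* Conjugation by a high power of [pi_step] makes the corner entry integral. *)
  have -> : mx2 1 x 0 1 = mx2 (pi ^- n0) 0 0 1 *m mx2 1 (pi ^+ n0 * x) 0 1 *m mx2 (pi ^+ n0) 0 0 1.
    rewrite !mx2M !(mulr0, mul0r, add0r, addr0, mulr1, mul1r).
    by rewrite mulrA mulVf ?expf_neq0 // mul1r.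
  apply: (PM); rewrite ?unitmx_mul ?du ?tu ?expf_neq0 ?invr_eq0 ?expf_neq0 //.
  apply: (PM); rewrite ?du ?tu ?invr_eq0 ?expf_neq0 //.
  by apply: PU; apply: GLO_mx2; rewrite ?av1 ?av0 ?ler01 ?mulr1 ?mulr0 ?subr0 ?av1.
have [U [S [UO Su ->]]] := iwasawa Bu.
have [SE s0 s1] := upper_mx2 Su; apply: (PM _ _ _ _ (PU _ UO)); [exact: GLO_unit UO|by case: Su|].
have -> : S = (S 1 1)%:M *m (mx2 1 (S 0 1 / S 1 1) 0 1 *m mx2 (S 0 0 / S 1 1) 0 0 1).
  rewrite {1}SE mx2_scalar !mx2M !(mulr0, mul0r, add0r, addr0, mulr1, mul1r).
  by congr mx2; rewrite mulrC divfK.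
apply: (PM); rewrite ?unitmx_mul ?tu ?du ?mulf_neq0 ?invr_eq0 //.
- by rewrite unitmx_det det_scalar expf_neq0.
- exact: Px.
- by apply: (PM); rewrite ?tu ?du ?mulf_neq0 ?invr_eq0 //;
  apply: Pdiag; rewrite mulf_neq0 ?invr_eq0.
Qed.

End ElementarySteps.

(** * Heights of linear forms on lattices *)

Section Heights.
Variables (R : realType) (K : fieldType) (abs : absolute_value R K).
Local Notation pi := (unif abs).
Local Notation bounded := (bounded abs).
Local Notation GLO := (GLO abs).
Local Notation rnorm := (rnorm abs).
Implicit Types (B G M S T U V : 'M[K]_2) (x y : K) (u v : 'rV[K]_2).

(** For [B] spanning a lattice [L], [rnorm (u *m invmx B)] is the norm of [u]
    attached to [L]; the product below depends only on the class of [L]. *)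
Definition height u v B := rnorm (u *m invmx B) * rnorm (v *m invmx B) * abs (\det B).

Lemma heightZ u v x B : x != 0 -> B \in unitmx -> height u v (x *: B) = height u v B.
Proof.
move=> x0 Bu; rewrite /height invmx_scale // -!scalemxAr !rnormZ detZ avM avX avV.
by have ax : abs x != 0; [rewrite av_eq0|field].
Qed.

Lemma height_le_mul u v M B : M \in unitmx -> B \in unitmx -> bounded 1 (invmx M) ->
  height u v (M *m B) <= abs (\det M) * height u v B.
Proof.
move=> Mu Bu M1; rewrite /height invmx_mul // !mulmxA det_mulmx avM mulrCA.
rewrite ler_wpM2l ?av_ge0 // ler_wpM2r ?av_ge0 // ler_pM ?rnorm_ge0 //.
  by have := rnormM (u *m invmx B) M1; rewrite mulr1.
by have := rnormM (v *m invmx B) M1; rewrite mulr1.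
Qed.

Lemma height_GLO u v U B : GLO U -> B \in unitmx -> height u v (U *m B) <= height u v B.
Proof.
move=> UO Bu; have [V1 _] := GLO_inv UO; have Uu := GLO_unit UO; case: UO => _ dU.
by have := height_le_mul u v Uu Bu V1; rewrite dU mul1r.
Qed.

(** Apply [height_le_mul] to [invmx M], whose inverse [M] is integral; its determinant supplies the
    factor 1 / |pi|. *)
Lemma height_step u v M B : elementary_step abs M -> B \in unitmx ->
  height u v B <= (abs pi)^-1 * height u v (M *m B).
Proof.
move=> Ms Bu; have Mu := elementary_step_unit Ms; case: Ms => M1 _ dM.
have := @height_le_mul u v (invmx M) (M *m B).
rewrite unitmx_inv unitmx_mul Mu invmxK mulKmx // det_inv avV dM; exact.
Qed.

Definition rows u v : 'M[K]_2 := mx2 (u 0 0) (u 0 1) (v 0 0) (v 0 1).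

Lemma rows_mul u v M : rows u v *m M = rows (u *m M) (v *m M).
Proof. by rewrite [M]mx2_eta [u]rv2_eta [v]rv2_eta !rv2M /rows !mxE /= mx2M. Qed.

Lemma det_rows_scaled u v M x y : rows u v \in unitmx -> u *m M = x *: u -> v *m M = y *: v ->
  \det M = x * y.
Proof.
rewrite unitmx_det => r0 uM vM; apply: (mulfI r0); rewrite -det_mulmx rows_mul uM vM.
by rewrite !det_mx2 !mxE /=; ring.
Qed.

Lemma rv2_rows u v x y : rv2 x y *m rows u v = x *: u + y *: v.
Proof. by apply/rowP; elim/ord2E; rewrite !mxE sum2 !mxE. Qed.

(** In the basis formed by [u] and [v] the two vectors become (1, 0) and (0, 1). Their norms 1 / |x|
    and 1 / |y| cancel the determinant of the diagonal factor. *)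
Lemma height_diag u v x y : rows u v \in unitmx -> x != 0 -> y != 0 ->
  height u v (mx2 x 0 0 y *m rows u v) = abs (\det (rows u v)).
Proof.
move=> Gu x0 y0; set D := mx2 x 0 0 y.
have dD : \det D = x * y by rewrite det_mx2 !mxE /= mulr0 subr0.
have Du : D \in unitmx by rewrite unitmx_det dD mulf_neq0.
have uE : u *m invmx (rows u v) = rv2 1 0.
  apply: (canLR (mulmxK Gu)); by rewrite rv2_rows scale1r scale0r addr0.
have vE : v *m invmx (rows u v) = rv2 0 1.
  apply: (canLR (mulmxK Gu)); by rewrite rv2_rows scale1r scale0r add0r.
have DE : invmx D = mx2 x^-1 0 0 y^-1.
  by rewrite invmx2 // dD mx2Z !mxE /= oppr0 !mulr0; congr mx2; field; rewrite x0 y0.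
rewrite /height invmx_mul // !mulmxA uE vE DE !rv2M det_mulmx dD /rnorm !mxE /=.
rewrite !(mulr0, mul0r, add0r, addr0, mulr1, mul1r) av0 !avM !avV.
have ax : abs x != 0 by rewrite av_eq0.
have ay : abs y != 0 by rewrite av_eq0.
rewrite (elimT max_idPl) ?(elimT max_idPr) ?invr_ge0 ?av_ge0 //.
by field; rewrite ax ay.
Qed.

(** The constant bounds the inverse of [rows u v], which recovers [M] from [u *m M] and [v *m M]. *)
Lemma bounded_rows u v : rows u v \in unitmx -> exists2 C, 0 < C &
  forall M m, rnorm (u *m M) <= m -> rnorm (v *m M) <= m -> bounded (C * m) M.
Proof.
move=> Gu; have [C C0 GC] := bounded_ex abs (invmx (rows u v)).
exists C => // M m; rewrite !rnorm_le => /andP[? ?] /andP[? ?].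
rewrite -(mulKmx Gu M); apply: boundedM => //.
by rewrite rows_mul; apply: bounded_mx2.
Qed.

Lemma rnormM_ge u M : M \in unitmx -> exists2 C, 0 < C &
  forall N, rnorm (u *m N) <= C * rnorm (u *m (N *m M)).
Proof.
move=> Mu; have [C C0 VC] := bounded_ex abs (invmx M).
exists C => // N; rewrite -{1}(mulmxK Mu N) mulrC [X in rnorm X]mulmxA.
exact: rnormM.
Qed.

End Heights.

(** * Geodesics *)

Section LinearForms.
Variable F : fieldType.

(** A linear form on column vectors whose kernel is the line [a]. *)
Definition ell (a : option F) : 'rV[F]_2 := if a is Some x then rv2 1 (- x) else rv2 0 1.

Lemma ell_neq0 a : ell a != 0.
Proof.
apply/eqP => /rowP e; move: (e 0) (e 1); case: a {e} => [x|]; rewrite !mxE /= => /eqP.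
  by rewrite oner_eq0.
by move=> _ /eqP; rewrite oner_eq0.
Qed.

Lemma rows_ell_unit a b : a <> b -> rows (ell b) (ell a) \in unitmx.
Proof.
rewrite unitmx_det det_mx2; case: a b => [x|] [y|] ab; rewrite !mxE /=.
- by rewrite mul1r mulr1 opprK addrC subr_eq0; apply/eqP => xy; apply: ab; rewrite xy.
- by rewrite mul0r sub0r mul1r oppr_eq0 oner_neq0.
- by rewrite mulr1 mulr0 subr0 oner_neq0.
- by case: ab.
Qed.

(** The hypothesis is [mobius g None = a] unfolded: the first column of [g] spans the line [a], on
    which [ell a] vanishes. *)
Lemma ell_infty (g : 'M[F]_2) a :
  (if g 1 0 == 0 then None else Some (g 0 0 / g 1 0)) = a -> (ell a *m g) 0 0 = 0.
Proof.
case: eqP => [c0 <-|/eqP c0 <-]; rewrite /ell [g]mx2_eta rv2M !mxE /=.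
  by rewrite mul0r add0r mul1r.
by rewrite mul1r mulNr divfK // subrr.
Qed.

(** The hypothesis is [mobius g a = a] unfolded: [g] preserves the line [a], hence also the line of
    forms vanishing on it. *)
Lemma ell_fixed (g : 'M[F]_2) a : g \in unitmx ->
  match a with
  | Some x => if g 1 0 * x + g 1 1 == 0 then None
              else Some ((g 0 0 * x + g 0 1) / (g 1 0 * x + g 1 1))
  | None => if g 1 0 == 0 then None else Some (g 0 0 / g 1 0)
  end = a -> exists2 m, m != 0 & ell a *m g = m *: ell a.
Proof.
move=> gu ga; suff [m e] : exists m, ell a *m g = m *: ell a.
  exists m => //; apply: contra_neq (ell_neq0 a) => m0.
  by move: e; rewrite m0 scale0r => /(congr1 (mulmx^~ (invmx g))); rewrite mulmxK // mul0mx.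
move: ga; case: a => [x|] /=.
  case: eqP => // /eqP d0 [/(canRL (divfK d0)) e].
  exists (g 0 0 - x * g 1 0); rewrite [in LHS](mx2_eta g) rv2M rv2Z.
  congr rv2; first by rewrite mul1r mulr1 mulNr.
  have -> : g 0 1 = x * (g 1 0 * x + g 1 1) - g 0 0 * x by rewrite -e [X in X - _]addrC addrK.
  by ring.
case: eqP => // c0 _; exists (g 1 1); rewrite [in LHS](mx2_eta g) rv2M rv2Z c0.
by congr rv2; rewrite ?(mul0r, mulr0, mul1r, mulr1, add0r).
Qed.

End LinearForms.

(** What is used of the Bruhat-Tits tree: [cl B] is the class of the lattice
    spanned by the rows of [B]. *)
Record lattice_tree (R : realType) (K : fieldType) (abs : absolute_value R K)
    (Vtx : Type) (cl : 'M[K]_2 -> Vtx) (adj : Vtx -> Vtx -> Prop) : Prop := LatticeTree {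
  cl_sim : forall (x : K) (U M N B : 'M[K]_2), x != 0 -> GLO abs U -> M = x *: (U *m N) ->
    cl (M *m B) = cl (N *m B);
  cl_eq : forall B B' : 'M[K]_2, B \in unitmx -> B' \in unitmx -> cl B = cl B' ->
    exists (x : K) (U : 'M[K]_2), [/\ x != 0, GLO abs U & B' = x *: (U *m B)];
  adjE : forall v w, adj v w -> exists B M,
    [/\ B \in unitmx, elementary_step abs M, v = cl B & w = cl (M *m B)]
}.

Section Geodesics.
Variables (R : realType) (K : fieldType) (abs : absolute_value R K).
Variables (Vtx : Type) (cl : 'M[K]_2 -> Vtx) (adj : Vtx -> Vtx -> Prop).
Hypothesis tree : lattice_tree abs cl adj.
Local Notation pi := (unif abs).
Local Notation pi_step := (pi_step abs).
Local Notation GLO := (GLO abs).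
Implicit Types (B G M T U : 'M[K]_2) (x y : K) (v w z : Vtx) (a b : option K).

Lemma cl_GLO U B : GLO U -> cl (U *m B) = cl B.
Proof.
move=> UO; rewrite -[in RHS](mul1mx B); apply: (cl_sim tree _ (oner_neq0 K) UO).
by rewrite scale1r mulmx1.
Qed.

(** [v] is the neighbour of [w] towards the end whose form is the second row of [G]. *)
Definition parent G v w := exists T,
  [/\ upper T, w = cl (T *m G) & v = cl (pi_step *m T *m G)].

(** The vertices of the apartment given by the two lines spanned by the rows of [G]. *)
Definition split_at G v := exists x y,
  [/\ x != 0, y != 0 & v = cl (mx2 x 0 0 y *m G)].

(** [elementary_step_upper] applies once the change of basis [U] between the two representatives of
    [w] is absorbed into the step; its first alternative would be backtracking to [v]. *)
Lemma parent_step G v w z : G \in unitmx ->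
  parent G v w -> adj w z -> z <> v -> parent G w z.
Proof.
move=> Gu [T [Tu wE vE]] /(adjE tree)[B [M [Bu Ms wB zB]]] zv.
have TGu : T *m G \in unitmx by rewrite unitmx_mul Gu; case: (Tu) => ->.
have [x [U [x0 UO BE]]] := cl_eq tree TGu Bu (etrans (esym wE) wB).
have zE : z = cl (M *m U *m T *m G).
  rewrite zB -[M *m B]mulmx1 -[M *m U *m T *m G]mulmx1.
  by apply: (cl_sim tree _ x0 (GLO1 abs)); rewrite mul1mx BE -scalemxAr !mulmxA.
have [[V VO e]|[V [S [VO Su e [y [V' [y0 V'O e']]]]]]] :=
  elementary_step_upper (elementary_step_mulr Ms UO) Tu.
  by case: zv; rewrite zE vE e -(mulmxA V) (cl_GLO _ VO).
exists S; split; first exact: Su.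
  by rewrite zE e -(mulmxA V) (cl_GLO _ VO).
by rewrite wE (cl_sim tree _ y0 V'O e').
Qed.

Lemma parent_split G v w : G \in unitmx -> parent G v w -> split_at G w -> split_at G v.
Proof.
move=> Gu [T [Tu wE vE]] [x [y [x0 y0 wD]]].
have TGu : T *m G \in unitmx by rewrite unitmx_mul Gu; case: (Tu) => ->.
have DGu : mx2 x 0 0 y *m G \in unitmx.
  by rewrite unitmx_mul Gu unitmx_det det_mx2 !mxE /= mulr0 subr0 mulf_neq0.
have [z [U [z0 UO e]]] := cl_eq tree TGu DGu (etrans (esym wE) wD).
have {}e : mx2 x 0 0 y = z *: (U *m T).
  by rewrite -[LHS](mulmxK Gu) e mulmxA scalemxAl mulmxK.
have [t [V [t0 VO e']]] := pi_step_diag Tu x0 y0 z0 UO e.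
exists (pi * x), y; split; [by rewrite mulf_neq0 ?unif_neq0|exact: y0|].
by rewrite vE (cl_sim tree _ t0 VO e').
Qed.

(** A tail of [x] is the image under [g] of a tail of the standard half-line, and the vanishing
    entry says that [g] sends infinity to [b]. *)
Definition toward b (x : nat -> Vtx) := exists2 g, g \in unitmx &
  (ell b *m g) 0 0 = 0 /\
  exists m n, forall i, x (m + i)%N = cl (mx2 (pi ^+ (n + i)) 0 0 1 *m invmx g).

(** The second row of [G] acts as [ell a] and kills the first column of [g], so [G *m g] is upper
    triangular. Going towards [a] is then going from child to parent. *)
Lemma parent_start G a (x : nat -> Vtx) : G \in unitmx ->
    (forall g : 'M[K]_2, (ell a *m g) 0 0 = (G *m g) 1 0) ->
  toward a x -> exists m, forall i, parent G (x (m + i.+1)%N) (x (m + i)%N).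
Proof.
move=> Gu aG [g gu [ga [m [n e]]]]; exists m => i.
have GgU : upper (G *m g) by split; [rewrite unitmx_mul Gu|rewrite -aG].
pose T := mx2 (pi ^+ (n + i)) 0 0 1 *m invmx (G *m g).
have Tu : upper T.
  apply: upper_mul (upper_inv GgU); apply: mx2_upper; last exact: oner_neq0.
  by rewrite expf_neq0 // unif_neq0.
have gE : invmx g = invmx (G *m g) *m G by rewrite (invmx_mul Gu gu) (mulmxKV Gu).
exists T; split; first exact: Tu.
  by rewrite e gE mulmxA.
rewrite e gE mulmxA; congr (cl (_ *m G)).
rewrite /T mulmxA; congr (_ *m _).
by rewrite mx2M !(mulr0, mul0r, add0r, addr0, mulr1, mul1r) addnS exprS.
Qed.

(** Here the first row of [G] kills the first column of [g], so the inverse of [G *m g] has lower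
    right entry 0, the shape treated by [diag_split]. *)
Lemma split_end G b (x : nat -> Vtx) : G \in unitmx ->
    (forall g : 'M[K]_2, (ell b *m g) 0 0 = (G *m g) 0 0) ->
  toward b x -> exists m, forall i, (m <= i)%N -> split_at G (x i).
Proof.
move=> Gu bG [g gu [gb [m [n e]]]].
have Ggu : G *m g \in unitmx by rewrite unitmx_mul Gu gu.
pose T := invmx (G *m g).
have Tu : T \in unitmx by rewrite unitmx_inv.
have T11 : T 1 1 = 0 by rewrite /T (invmx2 Ggu) mxE [mx2 _ _ _ _ _ _]mxE /= -bG gb mulr0.
have TE : T = mx2 (T 0 0) (T 0 1) (T 1 0) 0 by rewrite [LHS]mx2_eta T11.
have [t0 s0] : T 0 1 != 0 /\ T 1 0 != 0.
  apply/andP; move: Tu; rewrite unitmx_det det_mx2 T11 mulr0 sub0r oppr_eq0.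
  by rewrite mulf_eq0 negb_or.
have gE : invmx g = T *m G by rewrite /T (invmx_mul Gu gu) (mulmxKV Gu).
have [n0 n0P] := diag_split abs (T 0 0) t0 s0.
exists (m + n0)%N => i mi; have -> : i = (m + (i - m))%N by lia.
have [|V VO VE] := n0P (n + (i - m))%N; first by lia.
exists (T 1 0), (pi ^+ (n + (i - m)) * T 0 1); split; first exact: s0.
  by rewrite mulf_neq0 // expf_neq0 // unif_neq0.
rewrite e gE mulmxA [in LHS]TE VE -mulmxA.
exact: cl_GLO VO.
Qed.

Lemma geodesic_split a b (x : int -> Vtx) n : a <> b ->
    (forall n, adj (x n) (x (n + 1)) /\ x n <> x (n + 2)) ->
    toward a (fun n => x (- n%:Z)) -> toward b (fun n => x n%:Z) ->
  split_at (rows (ell b) (ell a)) (x n).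
Proof.
move=> ab path xa xb; set G := rows _ _.
have Gu : G \in unitmx := rows_ell_unit ab.
have Ga (g : 'M[K]_2) : (ell a *m g) 0 0 = (G *m g) 1 0 by rewrite rows_mul [RHS]mxE.
have Gb (g : 'M[K]_2) : (ell b *m g) 0 0 = (G *m g) 0 0 by rewrite rows_mul [RHS]mxE.
have [m mP] := parent_start Gu Ga xa; have [m' m'P] := split_end Gu Gb xb.
(* Parenthood holds near the end [a] and is carried forward by [parent_step], as the path does not
   backtrack. *)
have par (N : int) : parent G (x (N - 1)) (x N).
  have base (j : nat) : parent G (x (- (m + j)%N%:Z - 1)) (x (- (m + j)%N%:Z)).
    have := mP j; rewrite /=.
    by have -> : - (m + j.+1)%N%:Z = - (m + j)%N%:Z - 1 by lia.
  have [Nm|Nm] := lerP N (- m%:Z).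
    have := base `|- m%:Z - N|%N.
    by have -> : - (m + `|- m%:Z - N|)%N%:Z = N by lia.
  have -> : N = - m%:Z + (absz (N + m%:Z))%:Z by lia.
  elim: (absz _) => [|j IH]; first by have := base 0%N; rewrite addn0 addr0.
  have [adj1 _] := path (- m%:Z + j%:Z); have [_ ne] := path (- m%:Z + j%:Z - 1).
  have -> : - m%:Z + j.+1%:Z - 1 = - m%:Z + j%:Z by lia.
  have E : - m%:Z + j.+1%:Z = - m%:Z + j%:Z + 1 by lia.
  rewrite E; apply: parent_step Gu IH adj1 _ => e; apply: ne; rewrite -e.
  by congr x; lia.
(* Vertices near the end [b] are split, and this is carried back to every vertex from child to
   parent. *)
have [Nm|Nm] := lerP m'%:Z n.
  have -> : n = `|n|%N%:Z by lia.
  by apply: m'P; lia.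
have -> : n = m'%:Z - `|m'%:Z - n|%N%:Z by lia.
elim: (absz _) => [|j IH]; first by rewrite subr0; apply: m'P.
have -> : m'%:Z - j.+1%:Z = m'%:Z - j%:Z - 1 by lia.
exact: parent_split Gu (par _) IH.
Qed.

Lemma height_cl (u v : 'rV[K]_2) B B' : B \in unitmx -> B' \in unitmx -> cl B = cl B' ->
  height abs u v B <= height abs u v B'.
Proof.
move=> Bu B'u /esym/(cl_eq tree B'u Bu)[x [U [x0 UO ->]]].
by rewrite heightZ ?unitmx_mul ?(GLO_unit UO) ?B'u // height_GLO.
Qed.

Lemma height_walk (u v : 'rV[K]_2) (x : nat -> Vtx) n B B' : B \in unitmx -> B' \in unitmx ->
    x 0%N = cl B -> x n = cl B' -> (forall i, (i < n)%N -> adj (x i) (x i.+1)) ->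
  height abs u v B <= (abs pi)^-1 ^+ n * height abs u v B'.
Proof.
elim: n x B => [|n IH] x B Bu B'u x0 xn path.
  by rewrite expr0 mul1r height_cl // -x0.
have [B1 [M [B1u Ms x0' x1]]] := adjE tree (path 0%N isT).
have MBu : M *m B1 \in unitmx by rewrite unitmx_mul (elementary_step_unit Ms).
apply: le_trans (height_cl u v Bu B1u (etrans (esym x0) x0')) _.
apply: le_trans (height_step u v Ms B1u) _.
rewrite exprS -mulrA ler_wpM2l ?invr_ge0 ?av_ge0 //.
by apply: (IH (fun i => x i.+1)) => // i lt_in; exact: (path i.+1).
Qed.

End Geodesics.

(** * Bounding a matrix through products of linear forms *)

Section BoundedByForms.
Variables (R : realType) (K : fieldType) (abs : absolute_value R K).
Local Notation bounded := (bounded abs).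
Local Notation rnorm := (rnorm abs).
Implicit Types (M : 'M[K]_2) (p : option K).

(** Summing the constants of [bounded_rows] over the finitely many pairs makes them uniform. *)
Lemma bounded_ell_pairs (T : finType) (pt : T -> option K) : exists2 D, 0 < D &
  forall s t M m, pt s <> pt t -> 0 <= m ->
    rnorm (ell (pt s) *m M) <= m -> rnorm (ell (pt t) *m M) <= m -> bounded (D * m) M.
Proof.
have /choice[D DP] : forall z : T * T, exists D, 0 < D /\ forall M m, pt z.1 <> pt z.2 ->
    rnorm (ell (pt z.1) *m M) <= m -> rnorm (ell (pt z.2) *m M) <= m -> bounded (D * m) M.
  move=> [s t] /=; have [e|ne] := pselect (pt s = pt t); first by exists 1; split.
  have [D D0 DP] := bounded_rows abs (rows_ell_unit (not_eq_sym ne)).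
  by exists D; split=> // M m _ ? ?; exact: DP.
exists (1 + \sum_z D z).
  by rewrite ltr_pwDl // sumr_ge0 // => z _; rewrite ltW //; case: (DP z).
move=> s t M m ne m0 sm tm; have [D0 DM] := DP (s, t).
apply: boundedW (DM M m ne sm tm); rewrite ler_wpM2r // (bigD1 (s, t)) //=.
rewrite addrCA lerDl addr_ge0 // sumr_ge0 // => z _.
by rewrite ltW //; case: (DP z).
Qed.

(** If the smallest factors of all the products belong to one point, that point
    is a common end, where the form is bounded below; otherwise two forms with
    different kernels are small. *)
Lemma bounded_of_products r (a b : 'I_r -> option K) C c0 :
    (1 <= r)%N -> (forall i, a i <> b i) -> 0 < c0 ->
  exists D, forall M,
    (forall p, (forall i, p = a i \/ p = b i) -> c0 <= rnorm (ell p *m M)) ->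
    (forall i, rnorm (ell (b i) *m M) * rnorm (ell (a i) *m M) <= C) -> bounded D M.
Proof.
move=> r1 ab c00.
have [D D0 DP] := bounded_ell_pairs (fun z : bool * 'I_r => if z.1 then a z.2 else b z.2).
(* From [B >= 1] and [B >= C] follows [B * B >= C], so two factors with product at most [C] cannot
   both exceed [B]. The term [C / c0] bounds a factor whose partner is at least [c0]. *)
pose B := Num.max (Num.max C 1) (C / c0).
have B1 : 1 <= B by rewrite !le_max lexx !orbT.
have BC : C <= B by rewrite !le_max lexx.
have BC0 : C / c0 <= B by rewrite !le_max lexx !orbT.
have B0 : 0 <= B := le_trans ler01 B1.
exists (D * B) => M lower prod.
have small i : exists z, rnorm (ell (if z then a i else b i) *m M) <= B.
  have [le|gt] := leP (rnorm (ell (a i) *m M)) B; first by exists true.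
  exists false; rewrite leNgt; apply/negP => gt'.
  have : B * B < C by apply: lt_le_trans (prod i); rewrite ltr_pM.
  by rewrite ltNge (le_trans BC) // ler_peMl.
pose i0 := Ordinal r1; have [z0 z0B] := small i0.
set p := (if z0 then a i0 else b i0) in z0B.
have [common|] := pselect (forall i, p = a i \/ p = b i).
  have pc := lower p common; have p0 := lt_le_trans c00 pc.
  apply: (DP (z0, i0) (~~ z0, i0)) => //=; first by case: (z0) => e; apply: (ab i0).
  apply: le_trans BC0; rewrite ler_pdivlMr //.
  apply: le_trans (prod i0); move: pc; rewrite /p; case: (z0) => pc /=.
    by rewrite ler_wpM2l ?rnorm_ge0.
  by rewrite mulrC ler_wpM2r ?rnorm_ge0.
move=> /existsNP[i /not_orP[pa pb]]; have [z zB] := small i.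
by apply: (DP (z0, i0) (z, i)) => //=; rewrite -/p; case: (z).
Qed.

(** Powers of [d] make the [ell a]-factor lie between [1] and [unif ^ |m|]. *)
Lemma hyperbolic_reduction a b (d : 'M[K]_2) mu nu C :
    a <> b -> d \in unitmx ->
    ell a *m d = mu *: ell a -> ell b *m d = nu *: ell b ->
    mu != 0 -> abs mu <> 1 -> abs (mu * nu) = 1 ->
  exists D, forall M, M \in unitmx -> rnorm (ell b *m M) * rnorm (ell a *m M) <= C ->
    exists n : int, bounded D (d ^ n *m M).
Proof.
move=> ab du da db mu0 mu1 munu.
have power (u : 'rV[K]_2) x (n : int) : u *m d = x *: u -> x != 0 -> u *m d ^ n = x ^ n *: u.
  move=> ud x0; have nat_power l : u *m d ^+ l = x ^+ l *: u.
    elim: l => [|l IH]; first by rewrite !expr0 mulmx1 scale1r.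
    by rewrite exprS mulmxA ud -scalemxAl IH scalerA -exprS.
  case: n => l; first by rewrite -!exprnP nat_power.
  rewrite NegzE -!exprnN; have dlu : d ^+ l.+1 \in unitmx by rewrite unitrX.
  have xl0 : x ^+ l.+1 != 0 by rewrite expf_neq0.
  apply: (can_inj (mulmxK dlu)); rewrite -scalemxAl nat_power scalerA mulVf // scale1r.
  by rewrite -mulmxA -[invmx _ *m _]/(_^-1 * _ : 'M_2) mulVr // mulmx1.
have nu0 : nu != 0.
  by apply: contra_eq_neq munu => ->; rewrite mulr0 av0 eq_sym oner_neq0.
have [m mE] := av_expz abs mu0.
have m0 : m != 0 by apply: contra_notN mu1 => /eqP m0; rewrite mE m0 expr0z.
have [D D0 DP] := bounded_rows abs (rows_ell_unit (not_eq_sym ab)).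
pose l := abs (unif abs) ^ `|m|%Z.
exists (D * Num.max 1 (C / l)) => M Mu prod.
have aM0 : ell a *m M != 0.
  apply: contra_neq (ell_neq0 a) => e; by rewrite -[LHS](mulmxK Mu) e mul0mx.
have [s sE] := rnorm_exists_expz abs aM0.
have l0 : 0 < l by rewrite exprz_gt0 // unif_gt0.
(* Multiplication by [d] shifts the exponent [s] of the [ell a]-factor by [m]. This power of [d]
   replaces [s] by its remainder modulo [m], which lies in [0, |m|). *)
exists (- (s %/ m)%Z); set n := - _.
have normE : rnorm (ell a *m (d ^ n *m M)) = abs (unif abs) ^ (s %% m)%Z.
  rewrite mulmxA (power _ _ _ da mu0) -scalemxAl rnormZ avXz mE sE exprz_exp.
  rewrite -expfzDr ?gt_eqF ?unif_gt0 //; congr (_ ^ _).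
  by rewrite /modz addrC /n mulrN mulrC.
have prodE : rnorm (ell b *m (d ^ n *m M)) * rnorm (ell a *m (d ^ n *m M)) <= C.
  rewrite !mulmxA (power _ _ _ da mu0) (power _ _ _ db nu0) -!scalemxAl !rnormZ mulrACA.
  by rewrite -avM -expfzMl mulrC [nu * _]mulrC avXz munu exp1rz mulr1.
have amod : l <= rnorm (ell a *m (d ^ n *m M)).
  by rewrite normE unif_expz_le ltW // ltz_mod.
apply: DP.
  by rewrite normE le_max -(expr0z (abs (unif abs))) unif_expz_le modz_ge0.
rewrite le_max ler_pdivlMr //; apply/orP; right.
by apply: le_trans prodE; rewrite ler_wpM2l ?rnorm_ge0.
Qed.

End BoundedByForms.

(** * The field of Laurent series *)

Section PowerSeriesUnits.
Variable k : fieldType.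
Implicit Types f g h : fps k.

Definition fpsX : fps k := Fps (fun n => (n == 1%N)%:R).

Lemma fpsXM f : f 0%N = 0 -> f = fpsX * Fps (fun n => f n.+1).
Proof.
move=> f0; apply: fpsP => -[|n] /=; first by rewrite big_ord_recl big_ord0 /= mul0r addr0.
rewrite big_ord_recl /= mul0r add0r big_ord_recl /= mul1r subSS subn0.
by rewrite big1 ?addr0 // => i _; rewrite mul0r.
Qed.

Lemma fpsXnM m f : (forall i, (i < m)%N -> f i = 0) ->
  exists2 h, f = fpsX ^+ m * h & forall n, h n = f (n + m)%N.
Proof.
elim: m => [|m IH] f0; first by exists f => [|n]; rewrite ?expr0 ?mul1r ?addn0.
have [i im|h fE hE] := IH; first by rewrite f0 // ltnS ltnW.
have h0 : h 0%N = 0 by rewrite hE add0n f0.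
exists (Fps (fun n => h n.+1)) => [|n /=]; last by rewrite hE addSnnS.
by rewrite exprSr -mulrA -fpsXM.
Qed.

(** [fps_recip g n] is correct up to index [n]. Returning a function gives the structural recursion
    access to all earlier coefficients of the inverse. *)
Fixpoint fps_recip g (n : nat) : nat -> k :=
  if n is n'.+1 then
    fun i => if (i <= n')%N then fps_recip g n' i
      else - (\sum_(j < n) fps_recip g n' j * g (n - j)%N) / g 0%N
  else fun=> (g 0%N)^-1.

Lemma fps_recip_stable g n i : (i <= n)%N -> fps_recip g n i = fps_recip g i i.
Proof.
elim: n => [|n IH]; first by rewrite leqn0 => /eqP ->.
by rewrite leq_eqVlt => /predU1P[-> //|]; rewrite ltnS => ile; rewrite -IH //= ile.
Qed.

Lemma fps_unitE g : g 0%N != 0 -> exists h, h * g = 1.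
Proof.
move=> g0; exists (Fps (fun n => fps_recip g n n)); apply: fpsP => -[|n] /=.
  by rewrite big_ord_recl big_ord0 addr0 /= mulVf.
rewrite big_ord_recr subnn /= ltnn mulfVK //; apply/eqP; rewrite subr_eq0; apply/eqP.
by apply: eq_bigr => i _; rewrite (@fps_recip_stable g n) // -ltnS.
Qed.

End PowerSeriesUnits.

Section AbsoluteValue.
Variables (R : realType) (k : finFieldType).
Local Notation K := (laurent k).
Local Notation abs := (@abs_inf R k).
Local Notation q := (#|k|%:R : R).
Implicit Types x y : K.

Lemma q_gt1 : 1 < q.
Proof. by rewrite ltr1n card_finNzRing_gt1. Qed.

Lemma q_gt0 : 0 < q. Proof. exact: lt_trans ltr01 q_gt1. Qed.

Lemma fracE x : exists f g : fps k, g != 0 /\ x = tofrac f / tofrac g.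
Proof.
exists \n_(repr x), \d_(repr x); split; first exact: denom_ratioP.
rewrite -[LHS]reprK -[X in \pi_(_)%qT X]Ratio_numden.
set f := \n_ _; set g := \d_ _; have g0 : g != 0 by exact: denom_ratioP.
rewrite /tofrac; unlock; rewrite -[X in _ * X]FracField.pi_inv -[RHS]FracField.pi_mul.
by rewrite /FracField.mulf /FracField.invf /= !numden_Ratio ?oner_eq0 ?(mul1r, mulr1).
Qed.

Lemma abs_frac (f g : fps k) : f != 0 -> g != 0 ->
  abs (tofrac f / tofrac g) = q ^ ((fps_ord g)%:Z - (fps_ord f)%:Z).
Proof.
move=> f0 g0; rewrite /abs_inf val_inf_frac // opprB ifN //.
by rewrite mulf_neq0 ?invr_eq0 ?tofrac_eq0.
Qed.

Lemma abs0 : abs 0 = 0. Proof. by rewrite /abs_inf eqxx. Qed.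

Lemma abs_gt0 x : (0 < abs x) = (x != 0).
Proof.
rewrite /abs_inf; case: eqP => _ /=; first exact: ltxx.
by rewrite exprz_gt0 // q_gt0.
Qed.

Lemma abs_ge0 x : 0 <= abs x.
Proof. by rewrite /abs_inf; case: eqP => // _; rewrite exprz_ge0 // ltW // q_gt0. Qed.

Lemma abs_eq0 x : (abs x == 0) = (x == 0).
Proof. by have := abs_gt0 x; rewrite lt_def abs_ge0 andbT => /negb_inj. Qed.

Lemma absM x y : abs (x * y) = abs x * abs y.
Proof.
have [f [g [g0 ->]]] := fracE x; have [f' [g' [g'0 ->]]] := fracE y.
have [->|f0] := eqVneq f 0; first by rewrite tofrac0 !mul0r abs0 mul0r.
have [->|f'0] := eqVneq f' 0; first by rewrite tofrac0 !mul0r mulr0 abs0 mulr0.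
rewrite mulrACA -invfM -!tofracM !abs_frac ?mulf_neq0 // !fps_ordM // !PoszD.
by rewrite opprD addrACA expfzDr // gt_eqF // q_gt0.
Qed.

Lemma abs1 : abs 1 = 1.
Proof.
have := absM 1 1; rewrite mulr1 => /esym/eqP; rewrite -subr_eq0 -{3}(mulr1 (abs 1)) -mulrBr.
by rewrite mulf_eq0 abs_eq0 oner_eq0 /= subr_eq0 => /eqP.
Qed.

Lemma absV x : abs x^-1 = (abs x)^-1.
Proof.
have [->|x0] := eqVneq x 0; first by rewrite invr0 abs0 invr0.
have ax : abs x != 0 by rewrite abs_eq0.
by apply: (mulfI ax); rewrite -absM !mulfV // abs1.
Qed.

(** Numerator and denominator are both divisible by the power of pi exactly dividing [g]; after
    cancellation the denominator has a nonzero constant term and is invertible. *)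
Lemma abs_frac_le1 (f g : fps k) : g != 0 ->
  abs (tofrac f / tofrac g) <= 1 -> exists h, tofrac f / tofrac g = tofrac h.
Proof.
move=> g0; have [->|f0] := eqVneq f 0; first by exists 0; rewrite tofrac0 mul0r.
rewrite abs_frac // -(expr0z q) ler_eXz2l ?q_gt1 // subr_le0 lez_nat => gf.
have [i|g' gE g'E] := @fpsXnM k (fps_ord g) g; first exact: fps_lt_ord.
have [i|f' fE _] := @fpsXnM k (fps_ord g) f.
  by move=> ig; apply/fps_lt_ord/(leq_trans ig).
have [h hg] : exists h, h * g' = 1.
  by apply: fps_unitE; rewrite g'E add0n fps_ord_neq0.
have g'0 : g' != 0 by apply: contra_eqN hg => /eqP ->; rewrite mulr0 eq_sym oner_eq0.
have X0 : @fpsX k ^+ fps_ord g != 0.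
  by apply: contraNneq g0 => e; rewrite gE e mul0r.
exists (f' * h); rewrite [in LHS]gE [in LHS]fE !tofracM invfM mulrACA divff ?tofrac_eq0 //.
rewrite mul1r; congr (_ * _).
have t0 : tofrac g' != 0 by rewrite tofrac_eq0.
by apply: (mulIf t0); rewrite mulVf // -tofracM hg tofrac1.
Qed.

Lemma Oinf_abs x : Oinf x <-> abs x <= 1.
Proof.
split=> [[f _ <-]|]; last first.
  by have [f [g [g0 ->]]] := fracE x => /(abs_frac_le1 g0)[h ->]; exists h.
have [->|f0] := eqVneq f 0; first by rewrite tofrac0 abs0 ler01.
rewrite -[tofrac f]divr1 -(tofrac1 (fps k)) abs_frac ?oner_neq0 //.
have -> : fps_ord (1 : fps k) = 0%N.
  by apply/eqP; rewrite -leqn0 fps_ord_min //= oner_neq0.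
by rewrite sub0r -(expr0z q) ler_eXz2l ?q_gt1 // oppr_le0.
Qed.

(** Dividing by the larger summand reduces this to the stability of the ring of integers under
    adding 1. *)
Lemma absD x y C : abs x <= C -> abs y <= C -> abs (x + y) <= C.
Proof.
suff H u v : abs v <= abs u -> abs (u + v) <= abs u.
  move=> xC yC; have [yx|/ltW xy] := leP (abs y) (abs x).
    exact: le_trans (H _ _ yx) xC.
  by rewrite addrC; apply: le_trans (H _ _ xy) yC.
have [->|u0] := eqVneq u 0.
  by rewrite abs0 => v0; rewrite add0r.
have au : 0 < abs u by rewrite abs_gt0.
move=> vu; have /Oinf_abs[f _ vE] : abs (v / u) <= 1.
  by rewrite absM absV ler_pdivrMr // mul1r.
have -> : u + v = (1 + v / u) * u by rewrite mulrDl mul1r divfK.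
rewrite absM ler_piMl // ?abs_ge0 //; apply/Oinf_abs; exists (1 + f) => //.
by rewrite tofracD tofrac1 vE.
Qed.

Local Notation pi := (@piinf k).

Lemma abs_pi : abs pi = q^-1.
Proof.
have X0 : fpsX k != 0.
  by apply/eqP => /(congr1 (fun f : fps k => f 1%N)) /eqP; rewrite /= oner_eq0.
have o1 (f : fps k) n : (forall i, (i < n)%N -> f i = 0) -> f n != 0 -> fps_ord f = n.
  move=> lt fn; apply/eqP; rewrite eqn_leq fps_ord_min //= leqNgt; apply/negP => /lt /eqP.
  by apply/negP/fps_ord_neq0; apply: contraNneq fn => ->.
rewrite /piinf -[tofrac _]divr1 -(tofrac1 (fps k)) abs_frac ?oner_neq0 //.
by rewrite (@o1 1 0%N) ?(@o1 (fpsX k) 1%N) //= ?oner_eq0 // => -[].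
Qed.

Lemma pi_neq0 : pi != 0.
Proof. by rewrite -abs_eq0 abs_pi invr_eq0 gt_eqF // q_gt0. Qed.

Lemma abs_pi_lt1 : abs pi < 1.
Proof. by rewrite abs_pi invf_lt1 ?q_gt1 ?q_gt0. Qed.

Lemma abs_expz x : x != 0 -> exists n : int, abs x = abs pi ^ n.
Proof.
by move=> x0; exists (val_inf x); rewrite /abs_inf (negPf x0) -/(abs pi) abs_pi exprz_inv.
Qed.

Definition laurent_abs : absolute_value R K :=
  AbsoluteValue abs0 abs_gt0 absM absD abs_pi_lt1 abs_expz pi_neq0.

Lemma Oinf_av x : Oinf x <-> laurent_abs x <= 1. Proof. exact: Oinf_abs. Qed.

Lemma abs_coef (f : fps k) m : (forall i, (i < m)%N -> f i = 0) ->
  laurent_abs (tofrac f) <= laurent_abs pi ^+ m.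
Proof.
move=> /fpsXnM[h -> _]; rewrite tofracM avM tofracXn avX.
by rewrite ler_piMr ?exprn_ge0 ?av_ge0 //; apply/Oinf_abs; exists h.
Qed.

Lemma const_inf_zmod : zmod_morphism (@const_inf k).
Proof.
move=> c d; rewrite /const_inf -tofracB; congr tofrac.
by apply: fpsP => -[|n] //=; rewrite subr0.
Qed.

Lemma const_inf_monoid : monoid_morphism (@const_inf k).
Proof.
split=> [|c d]; rewrite /const_inf -?tofracM -?tofrac1; congr tofrac.
  by apply: fpsP => -[|n].
apply: fpsP => -[|n] /=; first by rewrite big_ord_recl big_ord0 addr0.
by rewrite big1 // => i _; case: ifP => [/eqP ->|_]; rewrite ?mulr0 ?mul0r.
Qed.

HB.instance Definition _ :=
  GRing.isZmodMorphism.Build k (laurent k) (@const_inf k) const_inf_zmod.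
HB.instance Definition _ :=
  GRing.isMonoidMorphism.Build k (laurent k) (@const_inf k) const_inf_monoid.

Lemma abs_const_inf c : c != 0 -> laurent_abs (const_inf c) = 1.
Proof.
have le1 d : laurent_abs (const_inf d) <= 1.
  by apply/Oinf_abs; exists (Fps (fun n => if n == 0%N then d else 0)).
move=> c0; apply/eqP; rewrite eq_le le1 -invf_le1 ?av_gt0 ?fmorph_eq0 //=.
by rewrite -(avV laurent_abs) -fmorphV le1.
Qed.

Lemma poly_inf_zmod : zmod_morphism (@poly_inf k).
Proof. by move=> p s; rewrite /poly_inf rmorphB hornerD hornerN. Qed.

Lemma poly_inf_monoid : monoid_morphism (@poly_inf k).
Proof. by split=> [|p s]; rewrite /poly_inf ?rmorph1 ?hornerC // rmorphM hornerM. Qed.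

HB.instance Definition _ :=
  GRing.isZmodMorphism.Build {poly k} (laurent k) (@poly_inf k) poly_inf_zmod.
HB.instance Definition _ :=
  GRing.isMonoidMorphism.Build {poly k} (laurent k) (@poly_inf k) poly_inf_monoid.

(** The leading term strictly dominates the others, since nonzero constants have value 1 and |T| = 1
    / |pi| > 1. *)
Lemma abs_poly_ge1 (p : {poly k}) : p != 0 -> 1 <= laurent_abs (poly_inf p).
Proof.
have pi1 : 1 < laurent_abs pi^-1 by rewrite avV invf_gt1 ?av_gt0 ?pi_neq0 // abs_pi_lt1.
rewrite -size_poly_gt0 => sp0; rewrite /poly_inf; move: sp0; case sp : (size p) => [//|n] _.
rewrite /map_poly horner_poly sp big_ord_recr /= addrC.
have la : laurent_abs (const_inf p`_n * pi^-1 ^+ n) = laurent_abs pi^-1 ^+ n.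
  rewrite avM avX abs_const_inf ?mul1r //.
  by rewrite -[n]/(n.+1.-1) -sp -lead_coefE lead_coef_eq0 -size_poly_eq0 sp.
rewrite avD_lt ?la; first by rewrite exprn_ege1 // ltW.
apply: (@av_sum_lt _ _ laurent_abs n (fun i => const_inf p`_i * pi^-1 ^+ i)).
  by rewrite exprn_gt0 // (lt_trans ltr01).
move=> i lt_in; rewrite avM avX.
have [->|c0] := eqVneq p`_i 0.
  by rewrite rmorph0 av0 mul0r exprn_gt0 // (lt_trans ltr01).
by rewrite abs_const_inf // mul1r ltr_eXn2l.
Qed.

Lemma Oinf_unit_abs x : Oinf_unit x -> laurent_abs x = 1.
Proof.
move=> [x0 [/Oinf_abs le1 /Oinf_abs]]; rewrite absV invf_le1 ?abs_gt0 // => ge1.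
by apply/eqP; rewrite eq_le le1.
Qed.

Lemma pi_small (c e : R) : 0 < e -> exists n, laurent_abs pi ^+ n * c < e.
Proof.
move=> e0; have q0 := q_gt0; pose n := Num.bound `|c / e|; exists n.
have : `|c / e| < q ^+ n.
  apply: lt_trans (archi_boundP (normr_ge0 _)) _.
  by rewrite -natrX ltr_nat ltn_expl // card_finNzRing_gt1.
rewrite -[laurent_abs pi]/(abs pi) abs_pi exprVn => lt.
rewrite mulrC ltr_pdivrMr ?exprn_gt0 // mulrC -ltr_pdivrMr //.
exact: le_lt_trans (ler_norm _) lt.
Qed.

End AbsoluteValue.

(** * Classes of lattices *)

Section Lattices.
Variables (R : realType) (k : finFieldType).
Local Notation K := (laurent k).
Local Notation abs := (laurent_abs R k).
Local Notation pi := (@piinf k).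
Local Notation bounded := (bounded abs).
Local Notation GLO := (GLO abs).
Local Notation elementary_step := (elementary_step abs).
Implicit Types (B M N U : 'M[K]_2) (x y : K).

Definition lat B : set 'rV[K]_2 := [set c *m B | c in [set c : 'rV[K]_2 | forall j, Oinf (c 0 j)]].

Definition lattice_class B : vtx k := homothety_class (lat B).

Lemma scale_lat x B : scale_set x (lat B) = lat (x *: B).
Proof.
rewrite /scale_set /lat image_comp; apply: eq_imagel => c _ /=.
by rewrite scalemxAr.
Qed.

Lemma lat_bounded M B : bounded 1 M -> lat (M *m B) `<=` lat B.
Proof.
move=> M1 _ [c cO <-]; exists (c *m M); last by rewrite mulmxA.
move=> j /=; apply/(@Oinf_av R); rewrite !mxE sum2.
by apply: avD; rewrite avM; apply: mulr_ile1; rewrite ?av_ge0 //;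
  [exact/Oinf_av/cO | exact: M1 | exact/Oinf_av/cO | exact: M1].
Qed.

(** The inclusion is tested on the rows of [B'], whose coordinates in the basis [B] are the rows of
    [B' *m invmx B]. *)
Lemma lat_sub B B' : B \in unitmx -> lat B' `<=` lat B -> bounded 1 (B' *m invmx B).
Proof.
move=> Bu sub i j; apply/Oinf_av.
have [|c cO cE] := sub (row i B').
  exists (delta_mx 0 i); last by rewrite -rowE.
  move=> j' /=; apply/(@Oinf_av R); rewrite mxE; case: (_ && _); rewrite ?av0 ?av1 ?ler01 //.
by have := cO j; rewrite -(mulmxK Bu c) cE -row_mul mxE.
Qed.

Lemma lat_quotient B B' : B \in unitmx -> bounded 1 (B' *m invmx B) -> lat B' `<=` lat B.
Proof. by move=> Bu /lat_bounded; rewrite -{2}(mulmxKV Bu B'); apply. Qed.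

Lemma lat_GLO U B : GLO U -> lat (U *m B) = lat B.
Proof.
move=> UO; apply/seteqP; split; first by apply: lat_bounded; case: UO.
rewrite -{1}(mulKmx (GLO_unit UO) B); apply: lat_bounded.
by case: (GLO_inv UO).
Qed.

Lemma lat_mem_class B : lattice_class B (lat B).
Proof.
exists 1; first exact: oner_neq0.
by rewrite scale_lat scale1r.
Qed.

Lemma lattice_classE B L : lattice_class B L <-> exists2 x, x != 0 & L = lat (x *: B).
Proof.
by split=> [[x x0 <-]|[x x0 ->]]; exists x => //; rewrite scale_lat.
Qed.

Lemma lattice_class_scale x B : x != 0 -> lattice_class (x *: B) = lattice_class B.
Proof.
move=> x0; apply/seteqP; split => L /lattice_classE[y y0 ->]; apply/lattice_classE.
  by exists (y * x); [exact: mulf_neq0|rewrite -(scalerA y)].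
exists (y / x); first by rewrite mulf_neq0 ?invr_eq0.
by rewrite (scalerA (y / x)) divfK.
Qed.

Lemma lattice_class_GLO U B : GLO U -> lattice_class (U *m B) = lattice_class B.
Proof. by move=> UO; rewrite /lattice_class lat_GLO. Qed.

Lemma lattice_class_eq B B' : B \in unitmx -> B' \in unitmx -> lattice_class B = lattice_class B' ->
  exists x U, [/\ x != 0, GLO U & B' = x *: (U *m B)].
Proof.
move=> Bu B'u e; have := lat_mem_class B'; rewrite -e => /lattice_classE[x x0 eL].
have xBu := unitmx_scale x0 Bu.
have [U UO B'E] : exists2 U, GLO U & B' = U *m (x *: B).
  apply: (GLO_quotient xBu B'u); [apply: (lat_sub xBu)|apply: (lat_sub B'u)];
  rewrite eL; exact: subset_refl.
by exists x, U; split; [exact: x0|exact: UO|rewrite scalemxAr].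
Qed.

Lemma lattice_class_sim x U M N B : x != 0 -> GLO U -> M = x *: (U *m N) ->
  lattice_class (M *m B) = lattice_class (N *m B).
Proof. by move=> x0 UO ->; rewrite -scalemxAl -mulmxA lattice_class_scale // lattice_class_GLO. Qed.

Lemma vertices_class B : B \in unitmx -> vertices (lattice_class B).
Proof. by move=> Bu; exists (lat B) => //; exists B. Qed.

Lemma verticesE (v : vtx k) : vertices v -> exists2 B, B \in unitmx & v = lattice_class B.
Proof. by case=> _ [B Bu ->] <-; exists B. Qed.

Lemma act_class g B : g \in unitmx -> act g (lattice_class B) = lattice_class (B *m invmx g).
Proof.
move=> gu.
have H x : [set u *m invmx g | u in lat (x *: B)] = lat (x *: (B *m invmx g)).
  rewrite /lat image_comp; apply: eq_imagel => c _ /=.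
  by rewrite -mulmxA scalemxAl.
apply/seteqP; split => [_ [L /lattice_classE[x x0 ->] <-]|L /lattice_classE[x x0 ->]].
  by apply/lattice_classE; exists x; [exact: x0|exact: H].
by exists (lat (x *: B)); [apply/lattice_classE; exists x|exact: H].
Qed.

Lemma std_vertexE (n : int) : std_vertex n = lattice_class (mx2 (unif abs ^ n) 0 0 1).
Proof.
rewrite -[unif abs]/pi /std_vertex /lattice_class; congr homothety_class; apply/seteqP; split.
  move=> _ [x xO [y yO <-]]; exists (rv2 x y); first by elim/ord2E; rewrite mxE.
  rewrite rv2M !mulr0 addr0 add0r mulr1.
  by apply/rowP; elim/ord2E; rewrite !mxE /= ?(mulr1, mulr0, addr0, add0r) // mulrC.
move=> _ [c cO <-]; exists (c 0 0); first exact: cO.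
exists (c 0 1); first exact: cO.
rewrite [X in _ = X *m _]rv2_eta rv2M !mulr0 addr0 add0r mulr1.
by apply/rowP; elim/ord2E; rewrite !mxE /= ?(mulr1, mulr0, addr0, add0r) // mulrC.
Qed.

Lemma adjacentE (v w : vtx k) : adjacent v w ->
  exists B M, [/\ B \in unitmx, elementary_step M, v = lattice_class B &
    w = lattice_class (M *m B)].
Proof.
case=> /verticesE[B0 B0u ->] /verticesE[B0' B0'u ->] 
  [L [L' [/lattice_classE[x x0 ->] /lattice_classE[x' x'0 ->]]]].
have Bu := unitmx_scale x0 B0u; have B'u := unitmx_scale x'0 B0'u.
rewrite -(lattice_class_scale B0 x0) -(lattice_class_scale B0' x'0).
set B := x *: B0 in Bu *; set B' := x' *: B0' in B'u *.
clearbody B B'.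
rewrite scale_lat => -[s1 n1] [s2 n2].
have pi0 := pi_neq0 R k.
have M1 := lat_sub Bu s2.
have [|||M Ms B'E] := @elementary_step_quotient _ _ abs B B' Bu B'u M1.
- by rewrite scalemxAl; apply: (lat_sub B'u s1).
- by move=> N1; apply: n2; exact: lat_quotient B'u N1.
- move=> N1; apply: n1; apply: lat_quotient; first exact: unitmx_scale pi0 Bu.
  rewrite (invmx_scale pi0 Bu) -scalemxAr; exact: N1.
by exists B, M; split; [exact: Bu|exact: Ms|by []|rewrite B'E].
Qed.

Lemma elementary_step_adjacent M B : B \in unitmx -> elementary_step M ->
  adjacent (lattice_class B) (lattice_class (M *m B)).
Proof.
have pi0 := pi_neq0 R k.
move=> Bu Ms; have Mu := elementary_step_unit Ms.
have MBu : M *m B \in unitmx by rewrite unitmx_mul Mu Bu.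
have [N1 N2] := elementary_step_strict Ms; case: Ms => M1 V1 _.
split; [exact: vertices_class Bu|exact: vertices_class MBu|].
exists (lat B), (lat (M *m B)); split; [exact: lat_mem_class|exact: lat_mem_class| |].
  rewrite scale_lat; split.
    have -> : pi *: B = (pi *: invmx M) *m (M *m B) by rewrite -scalemxAl (mulKmx Mu).
    exact: lat_bounded V1.
  move/(lat_sub (unitmx_scale pi0 Bu)).
  rewrite (invmx_scale pi0 Bu) -scalemxAr (mulmxK Bu); exact: N2.
split; first exact: lat_bounded M1.
move/(lat_sub MBu); rewrite (invmx_mul Mu Bu) mulmxA (mulmxV Bu) mul1mx; exact: N1.
Qed.

Lemma laurent_tree : lattice_tree abs lattice_class (@adjacent k).
Proof.
split; [exact: lattice_class_sim|exact: lattice_class_eq|exact: adjacentE].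
Qed.

End Lattices.

(** * Walks in the tree *)

Section Walks.
Variables (R : realType) (k : finFieldType).
Local Notation K := (laurent k).
Local Notation abs := (laurent_abs R k).
Local Notation pi := (unif abs).
Local Notation cl := (@lattice_class k).
Implicit Types (A B M g : 'M[K]_2) (v w z : vtx k) (a b : P1 k).

Lemma walk_cat v w z m n : walk_lengths v w m -> walk_lengths w z n ->
  walk_lengths v z (m + n)%N.
Proof.
move=> [x [xv xw xadj]] [y [yw yz yadj]].
exists (fun i => if (i <= m)%N then x i else y (i - m)%N); split=> [//||i lt].
  case: ifP => [le|_]; last by rewrite addKn.
  (* The final vertex falls in the first branch only if the second walk has length 0. *)
  have n0 : n = 0%N by lia.
  by rewrite n0 addn0 xw -yw -yz n0.
have [ltm|gem] := ltnP i m; first by rewrite ltnW //; exact: xadj.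
have -> : (if (i <= m)%N then x i else y (i - m)%N) = y (i - m)%N.
  case: ifP => // im; have -> : i = m by lia.
  by rewrite subnn yw.
by rewrite subSn //; apply: yadj; lia.
Qed.

Lemma adjacent_sym v w : adjacent v w -> adjacent w v.
Proof.
move=> /(adjacentE R)[B [M [Bu Ms -> ->]]]; have Mu := elementary_step_unit Ms.
have MBu : M *m B \in unitmx by rewrite unitmx_mul Mu Bu.
have := elementary_step_adjacent MBu (elementary_step_sym Ms).
by rewrite -scalemxAl (mulKmx Mu) (lattice_class_scale _ (unif_neq0 abs)).
Qed.

Lemma walk_sym v w n : walk_lengths v w n -> walk_lengths w v n.
Proof.
move=> [x [xv xw xadj]]; exists (fun i => x (n - i)%N); split; rewrite ?subn0 ?subnn // => i lt.
apply: adjacent_sym; have -> : (n - i = (n - i.+1).+1)%N by lia.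
by apply: xadj; lia.
Qed.

Lemma act_adjacent g v w : g \in unitmx -> adjacent v w -> adjacent (act g v) (act g w).
Proof.
move=> gu /(adjacentE R)[B [M [Bu Ms -> ->]]]; rewrite !(act_class _ gu) -mulmxA.
by apply: elementary_step_adjacent Ms; rewrite unitmx_mul Bu unitmx_inv gu.
Qed.

Lemma act_walk g v w n : g \in unitmx -> walk_lengths v w n ->
  walk_lengths (act g v) (act g w) n.
Proof.
move=> gu [x [xv xw xadj]]; exists (fun i => act g (x i)); split; rewrite ?xv ?xw // => i lt.
exact: act_adjacent gu (xadj i lt).
Qed.

Definition connected v w := exists n, walk_lengths v w n.

Lemma connected_cat v w z : connected v w -> connected w z -> connected v z.
Proof. by move=> [m mP] [n nP]; exists (m + n)%N; exact: walk_cat mP nP. Qed.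

Lemma connected_mulr A B M : M \in unitmx -> connected (cl A) (cl B) ->
  connected (cl (A *m M)) (cl (B *m M)).
Proof.
move=> Mu [n]; have Vu : invmx M \in unitmx by rewrite unitmx_inv.
by move/(act_walk Vu); rewrite !(act_class _ Vu) invmxK; exists n.
Qed.

Lemma connected_refl v : connected v v.
Proof. by exists 0%N, (fun=> v). Qed.

(** Being connected to the standard vertex passes to products and inverses because right
    multiplication preserves walks, so generators suffice. *)
Lemma lattice_class_connected B : B \in unitmx -> connected (cl 1%:M) (cl B).
Proof.
move: B; apply: (@GL2_generated _ _ abs (fun B => connected (cl 1%:M) (cl B))) =>
  [U UO|x x0||M N Mu Nu PM PN|M Mu PM].
- by rewrite -[U]mulmx1 (lattice_class_GLO _ UO); exact: connected_refl.
- by rewrite -[x%:M]scalemx1 (lattice_class_scale _ x0); exact: connected_refl.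
- exists 1%N, (fun i => if i == 0%N then cl 1%:M else cl (pi_step abs)).
  split=> // i; rewrite ltnS leqn0 => /eqP -> /=.
  by have := elementary_step_adjacent (unitmx1 _ _) (pi_stepP abs); rewrite mulmx1.
- by apply: connected_cat PN _; have := connected_mulr Nu PM; rewrite mul1mx.
- have Vu : invmx M \in unitmx by rewrite unitmx_inv.
  have [n] := connected_mulr Vu PM; rewrite mul1mx (mulmxV Mu).
  by move/walk_sym; exists n.
Qed.

Lemma vertices_connected v w : vertices v -> vertices w -> connected v w.
Proof.
move=> /verticesE[A Au ->] /verticesE[B Bu ->].
have [n /walk_sym vn] := lattice_class_connected Au.
by apply: connected_cat (lattice_class_connected Bu); exists n.
Qed.

(** Walk lengths are integers: an infimum below [N + 1] is witnessed by a walk of length at most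
    [N]. *)
Lemma dist_to_leP v S N : (dist_to R v S <= N%:R%:E)%E <->
  exists w n, [/\ S w, (n <= N)%N & walk_lengths v w n].
Proof.
split=> [le|[w [n [Sw nN wn]]]].
  have /ereal_inf_lt[_ [w Sw <-]] : (dist_to R v S < N.+1%:R%:E)%E.
    by apply: le_lt_trans le _; rewrite lte_fin ltr_nat.
  move=> /ereal_inf_lt[_ [n wn <-]]; rewrite lte_fin ltr_nat ltnS => nN.
  by exists w, n.
apply: ge_ereal_inf; exists (dist R v w); first by exists w.
apply: ge_ereal_inf; exists n%:R%:E; first by exists n.
by rewrite lee_fin ler_nat.
Qed.

(** If a walk of length [d] joins [v] to [w], its translate by [g] shows that a coset counted for
    [w] and [N] is counted for [v] and [d + N]. *)
Lemma propP_some_all G H r (a b : 'I_r -> P1 k) : G `<=` @GL2 k ->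
  propP_some R G H a b <-> propP_all R G H a b.
Proof.
move=> GU; split=> [[v vv fin] w ww N|all]; last first.
  have vv : vertices (cl 1%:M) by apply: vertices_class; exact: unitmx1.
  by exists (cl 1%:M) => // N; exact: all.
have [d vw] := vertices_connected vv ww.
apply: sub_finite_set (fin (d + N)%N) => _ [g [Gg near] <-].
exists g => //; split=> // i; have /dist_to_leP[z [n [zS nN wz]]] := near i.
apply/dist_to_leP; exists z, (d + n)%N; split=> //; first by rewrite leq_add2l.
exact: walk_cat (act_walk (GU _ Gg) vw) wz.
Qed.

Lemma represents_toward a x : represents x a -> toward abs cl a x.
Proof.
move=> [_ [g gu [ga [m [n e]]]]]; exists g => //; split; first exact: ell_infty ga.
exists m, n => i; rewrite e (std_vertexE R) (act_class _ gu).
by [].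
Qed.

(** Since [g] acts through its inverse, [g v_0] is the class of [invmx g]. A walk of length at most
    [N] joins it to a split class, whose height is known. *)
Lemma geodesic_height a b g N : a <> b -> g \in unitmx ->
    (dist_to R (act g (cl 1%:M)) (geodesic a b) <= N%:R%:E)%E ->
  height abs (ell b) (ell a) (invmx g) <= (abs pi)^-1 ^+ N * abs (\det (rows (ell b) (ell a))).
Proof.
move=> ab gu /dist_to_leP[w [n [[x [adj xa xb] [i _ iw]] nN [y [y0 yn ypath]]]]].
have Gu := rows_ell_unit ab.
have [s [t [s0 t0 xE]]] := geodesic_split (laurent_tree R k) i ab adj
  (represents_toward xa) (represents_toward xb).
have Du : mx2 s 0 0 t \in unitmx by rewrite unitmx_det det_mx2 !mxE /= mulr0 subr0 mulf_neq0.
have Vu : invmx g \in unitmx by rewrite unitmx_inv; exact: gu.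
have DGu : mx2 s 0 0 t *m rows (ell b) (ell a) \in unitmx by rewrite unitmx_mul Du Gu.
rewrite (act_class _ gu) mul1mx in y0; rewrite -iw xE in yn.
apply: le_trans (height_walk (laurent_tree R k) (ell b) (ell a) Vu DGu y0 yn ypath) _.
rewrite (height_diag _ Gu s0 t0) ler_wpM2r ?av_ge0 // ler_weXn2l //.
by rewrite invf_ge1 ?unif_gt0 // ltW // unif_lt1.
Qed.

End Walks.

(** * Discreteness *)

Section Discreteness.
Variables (R : realType) (k : finFieldType).
Local Notation K := (laurent k).
Local Notation abs := (laurent_abs R k).
Local Notation pi := (unif abs).
Local Notation bounded := (bounded abs).

(** The first [n] coefficients of pi^m x, in a finite type. The default 0 of [xget] occurs only when
    pi^m x is not integral. *)
Definition digits n m (x : K) : {ffun 'I_n -> k} :=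
  [ffun i : 'I_n => xget 0 [set f : fps k | tofrac f = pi ^+ m * x] i].

Lemma digits_inj n m x y : abs (pi ^+ m * x) <= 1 -> abs (pi ^+ m * y) <= 1 ->
  digits n m x = digits n m y -> abs (pi ^+ m * (y - x)) <= abs pi ^+ n.
Proof.
move=> /Oinf_av[f _ fx] /Oinf_av[f' _ fy] e.
pose g z := xget (0 : fps k) [set f : fps k | tofrac f = pi ^+ m * z].
have gx : tofrac (g x) = pi ^+ m * x by rewrite /g; case: xgetP => // /(_ f).
have gy : tofrac (g y) = pi ^+ m * y by rewrite /g; case: xgetP => // /(_ f').
rewrite mulrBr -gx -gy -tofracB; apply: abs_coef => i lt_in.
have := congr1 (fun h : {ffun 'I_n -> k} => h (Ordinal lt_in)) e.
by rewrite !ffunE -/(g x) -/(g y) /= => ->; rewrite subrr.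
Qed.

Lemma finite_set_inj (T : choiceType) (U : finType) (A : set T) (F : T -> U) :
  (forall x y, A x -> A y -> F x = F y -> x = y) -> finite_set A.
Proof.
move=> inj; have [[x0 Ax0]|A0] := pselect (exists x, A x); last first.
  by apply: sub_finite_set (finite_set0 _) => x Ax; apply: A0; exists x.
have fin : finite_set [set: U] by exact: finite_finset.
pose G u := xget x0 [set x | A x /\ F x = u].
apply: sub_finite_set (finite_image G fin) => x Ax; exists (F x) => //.
rewrite /G; case: xgetP => [y _ [Ay e]|/(_ x)[]//].
exact: inj.
Qed.

(** Isolation of the identity is transported by left translation: [invmx g] is bounded by [C]
    because the determinant is a unit, so [invmx g *m h] is close to 1. *)
Lemma discrete_sub (G : set 'M[K]_2) : is_subgroup G -> discrete R G ->
  (forall g, G g -> abs (\det g) = 1) -> forall C, 0 < C -> exists2 e, 0 < e &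
  forall g h, G g -> G h -> bounded C g -> bounded e (h - g) -> h = g.
Proof.
move=> [GU G1 GM GV] disc Gdet C C0; have [e e0 eP] := disc _ G1.
(* The factor 2 turns the weak bound on products into the strict one of [discrete]. *)
exists (e / (2 * C)); first by rewrite divr_gt0 // mulr_gt0.
move=> g h Gg Gh gC hg; have gu : g \in unitmx := GU _ Gg.
have Vg := bounded_invmx gu gC; rewrite (Gdet _ Gg) divr1 in Vg.
suff : invmx g *m h = 1%:M.
  by move/(congr1 (mulmx g)); rewrite mulKVmx // mulmx1.
apply: eP; first by apply: GM => //; exact: GV.
move=> i j; have -> : (invmx g *m h) i j - (1%:M : 'M[K]_2) i j = (invmx g *m (h - g)) i j.
  by rewrite mulmxBr (mulVmx gu) !mxE.
apply: le_lt_trans (boundedM Vg hg i j) _.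
have -> : C * (e / (2 * C)) = e / 2 by field; rewrite gt_eqF.
by rewrite ltr_pdivrMr // ltr_pMr // ltr1n.
Qed.

(** Scaling by pi^m makes all entries integral. Two elements whose scaled entries share [n] digits
    are within [e], hence equal, and there are finitely many digit patterns. *)
Lemma finite_bounded (G : set 'M[K]_2) C : is_subgroup G -> discrete R G ->
  (forall g, G g -> abs (\det g) = 1) -> finite_set [set g | G g /\ bounded C g].
Proof.
move=> Gs Gd Gdet; pose C' := Num.max C 1.
have C'0 : 0 < C' by rewrite lt_max ltr01 orbT.
have CC' : C <= C' by rewrite le_max lexx.
have [e e0 eP] := discrete_sub Gs Gd Gdet C'0.
have [m mP] := pi_small k C' (@ltr01 R).
have pm0 : 0 < abs pi ^+ m by rewrite exprn_gt0 // unif_gt0.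
have [n nP] := pi_small k (abs pi ^+ m)^-1 e0.
apply: (@finite_set_inj _ _ _ (fun g : 'M[K]_2 =>
  [ffun ij : 'I_2 * 'I_2 => digits n m (g ij.1 ij.2)])).
move=> g h [Gg gC] [Gh hC] /ffunP E.
have small (M : 'M[K]_2) i j : bounded C M -> abs (pi ^+ m * M i j) <= 1.
  move=> MC; rewrite avM avX; apply: le_trans (ltW mP); rewrite ler_wpM2l ?(ltW pm0) //.
  exact: le_trans (MC i j) CC'.
apply/esym; apply: eP => //; first exact: boundedW CC' gC.
move=> i j; have := E (i, j); rewrite !ffunE /= => /digits_inj.
move=> /(_ (small _ _ _ gC) (small _ _ _ hC)); rewrite avM avX mulrC -ler_pdivlMr // => le.
by rewrite !mxE; apply: le_trans le (ltW nP).
Qed.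

End Discreteness.

(** * Finiteness of cosets *)

Section Cosets.
Variables (R : realType) (k : finFieldType).
Local Notation K := (laurent k).
Local Notation abs := (laurent_abs R k).
Local Notation pi := (unif abs).
Local Notation bounded := (bounded abs).
Local Notation rnorm := (rnorm abs).
Local Notation cl := (@lattice_class k).

Lemma geodesic_product a b g N : a <> b -> g \in unitmx -> abs (\det g) = 1 ->
    (dist_to R (act g (cl 1%:M)) (geodesic a b) <= N%:R%:E)%E ->
  rnorm (ell b *m g) * rnorm (ell a *m g) <= (abs pi)^-1 ^+ N * abs (\det (rows (ell b) (ell a))).
Proof.
move=> ab gu dg near; have := geodesic_height ab gu near.
by rewrite /height invmxK det_inv avV dg invr1 mulr1.
Qed.

Section Family.
Variables (G : set 'M[K]_2) (r : nat) (a b : 'I_r -> P1 k).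
Hypotheses (Gs : is_subgroup G) (Gd : discrete R G).
Hypothesis Gdet : forall g, G g -> abs (\det g) = 1.
Hypothesis ab : forall i, a i <> b i.

Lemma near_products N : exists C, forall g, G g ->
    (forall i, (dist_to R (act g (cl 1%:M)) (geodesic (a i) (b i)) <= N%:R%:E)%E) ->
  forall i, rnorm (ell (b i) *m g) * rnorm (ell (a i) *m g) <= C.
Proof.
pose F i := (abs pi)^-1 ^+ N * abs (\det (rows (ell (b i)) (ell (a i)))).
have F0 i : 0 <= F i by rewrite mulr_ge0 ?av_ge0 // exprn_ge0 // invr_ge0 av_ge0.
exists (\sum_i F i) => g Gg near i.
have gu : g \in unitmx by case: Gs => GU _ _ _; exact: GU.
apply: le_trans (geodesic_product (@ab i) gu (Gdet Gg) (near i)) _.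
by rewrite -/(F i) (bigD1 i) //= lerDl sumr_ge0.
Qed.

(** Common to all cases but the hyperbolic one, which differ only in how the forms at common ends
    are bounded below. *)
Lemma propP_of_lower_bound (H : set 'M[K]_2) c0 : (1 <= r)%N -> 0 < c0 ->
    (forall g p, G g -> (forall i, p = a i \/ p = b i) -> c0 <= rnorm (ell p *m g)) ->
  propP_some R G H a b.
Proof.
move=> r1 c00 lower; exists (cl 1%:M); first by apply: vertices_class; exact: unitmx1.
move=> N; have [C CP] := near_products N.
have [D DP] := bounded_of_products abs C r1 ab c00.
apply: sub_finite_set (finite_image (rcoset H) (finite_bounded D Gs Gd Gdet)).
move=> _ [g [Gg near] <-]; exists g => //; split; first exact: Gg.
by apply: DP => [p pab|]; [exact: lower|exact: CP].
Qed.

End Family.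

(** * Lower bounds at rational points *)

Lemma ratfun_vector c : P1F c -> exists t (u : 'rV[{poly k}]_2),
  [/\ t != 0, u != 0 & t *: ell c = map_mx (@poly_inf k) u].
Proof.
have nz (u : 'rV[{poly k}]_2) i : u 0 i != 0 -> u != 0 by apply: contra_neq => ->; rewrite mxE.
case: c => [x [p [s [s0 ->]]]|_]; last first.
  exists 1, (rv2 0 1); split; [exact: oner_neq0|by apply: (nz _ 1); rewrite mxE oner_neq0|].
  by rewrite scale1r; apply/rowP; elim/ord2E; rewrite !mxE /= ?rmorph0 ?rmorph1.
have ps0 : poly_inf s != 0 by rewrite -(av_gt0 abs) (lt_le_trans ltr01) // abs_poly_ge1.
exists (poly_inf s), (rv2 s (- p)); split; [exact: ps0|by apply: (nz _ 0); rewrite mxE|].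
rewrite rv2Z mulr1 mulrN mulrC divfK //.
by apply/rowP; elim/ord2E; rewrite !mxE /= ?rmorphN.
Qed.

(** The scalar [t] clears denominators, so [t *: (ell c *m h)] is a nonzero vector of A^2 and has
    norm at least 1. *)
Lemma GL2A_lower_bound c : P1F c -> exists2 c0, 0 < c0 &
  forall h, GL2A h -> c0 <= rnorm (ell c *m h).
Proof.
move=> /ratfun_vector[t [u [t0 u0 tu]]]; have at0 : 0 < abs t by rewrite av_gt0.
exists (abs t)^-1; first by rewrite invr_gt0.
move=> _ [M Mu <-]; rewrite -[leRHS](mulKf (lt0r_neq0 at0)) -rnormZ.
rewrite scalemxAl tu -map_mxM ler_peMr ?invr_ge0 ?av_ge0 //.
have uM0 : u *m M != 0 by apply: contra_neq u0 => e; rewrite -[LHS](mulmxK Mu) e mul0mx.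
have [j uMj] : exists j, (u *m M) 0 j != 0.
  apply/existsP; apply: contra_neqT uM0 => /existsPn z; apply/rowP => j.
  by rewrite [RHS]mxE; apply/eqP/negPn; exact: z.
by apply: le_trans (abs_rnorm _ _ j); rewrite mxE; apply: abs_poly_ge1.
Qed.

Lemma finite_lower_bound (T : choiceType) (A : set T) (P : T -> R -> Prop) : finite_set A ->
    (forall x c d, d <= c -> P x c -> P x d) ->
    (forall x, A x -> exists2 c, 0 < c & P x c) ->
  exists2 c, 0 < c & forall x, A x -> P x c.
Proof.
move=> /finite_seqP[s ->] anti; elim: s => [|x s IH] H; first by exists 1.
have [|c c0 cP] := IH; first by move=> y ys; apply: H; rewrite /= inE ys orbT.
have [d d0 dP] := H x (mem_head _ _).
exists (Num.min c d); first by rewrite lt_min c0.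
move=> y; rewrite /= inE => /predU1P[->|ys].
  by apply: anti dP; rewrite ge_min lexx orbT.
by apply: anti (cP y ys); rewrite ge_min lexx.
Qed.

(** On each of the finitely many cosets of the intersection, the bound for [GL2A] changes by a
    constant depending only on the representative. *)
Lemma commensurable_lower_bound G c : is_subgroup G -> commensurable G (@GL2A k) -> P1F c ->
  exists2 c0, 0 < c0 & forall g, G g -> c0 <= rnorm (ell c *m g).
Proof.
move=> [GU G1 _ _] [fin _] /GL2A_lower_bound[c1 c10 c1P].
pose Q := G `&` @GL2A k.
have [c0 c00 c0P] : exists2 c0, 0 < c0 & forall X, rcosets Q G X ->
    forall g, X g -> c0 <= rnorm (ell c *m g).
  apply: finite_lower_bound fin _ _ => [X d e ed H g Xg|_ [g Gg <-]].
    exact: le_trans ed (H g Xg).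
  have [C C0 CP] := rnormM_ge abs (ell c) (GU _ Gg).
  exists (c1 / C); first by rewrite divr_gt0.
  move=> _ [h [_ hA] <-]; rewrite ler_pdivrMr // mulrC.
  exact: le_trans (c1P h hA) (CP h).
exists c0 => // g Gg; apply: (c0P (rcoset Q g)); first by exists g.
exists 1%:M; last by rewrite mul1mx.
split; first exact: G1.
exists 1%:M; first exact: unitmx1.
exact: map_mx1.
Qed.

(** * Hyperbolic elements and the cosets of the group they generate *)

Lemma hyperbolic_eigenvalue d (u : 'rV[K]_2) mu : hyperbolic R d -> abs (\det d) = 1 ->
  u != 0 -> u *m d = mu *: u -> abs mu <> 1.
Proof.
move=> [_ [C [iota [absC [_ [_ _ absCM _ absCi] [l1 [l2 [cp ne]]]]]]]] dd u0 ud mu1.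
have rt : root (char_poly d) mu by rewrite -eigenvalue_root_char; apply/eigenvalueP; exists u.
have : root (map_poly iota (char_poly d)) (iota mu) by rewrite fmorph_root.
(* The constant term of the characteristic polynomial is the determinant, a unit. If the root
   [iota mu] had value 1, so would the other root. *)
have p12 : absC l1 * absC l2 = 1.
  rewrite -absCM -[RHS]dd -[abs _]/(abs_inf R (\det d)) -absCi; congr absC.
  have := char_poly_det d; rewrite -[_`_0]horner_coef0 => /(congr1 iota).
  rewrite rmorphM rmorphXn rmorphN1 sqrrN expr1n mul1r => <-.
  have -> : iota (char_poly d).[0] = (map_poly iota (char_poly d)).[iota 0] by rewrite horner_map.
  by rewrite cp rmorph0 hornerM !hornerXsubC !sub0r mulrNN.
have i1 : absC (iota mu) = 1 by rewrite absCi.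
rewrite cp rootM !root_XsubC => /orP[] /eqP e; apply: ne; move: p12; rewrite -e i1.
  by rewrite mul1r => ->.
by rewrite mulr1 => ->.
Qed.

Lemma rcoset_mull (H : set 'M[K]_2) h g : is_subgroup H -> H h -> rcoset H (h *m g) = rcoset H g.
Proof.
move=> [HU _ HM HV] Hh; apply/seteqP; split=> _ [h' Hh' <-].
  by exists (h' *m h); [exact: HM|rewrite mulmxA].
exists (h' *m invmx h); first by apply: HM => //; exact: HV.
by rewrite -mulmxA (mulKmx (HU _ Hh)).
Qed.

Lemma propP_hyperbolic (G : set 'M[K]_2) d (a b : 'I_1 -> P1 k) :
    is_subgroup G -> discrete R G -> (forall g, G g -> abs (\det g) = 1) ->
    (forall i, a i <> b i) -> G d -> hyperbolic R d -> is_subgroup (generated d) ->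
    generated d `<=` G ->
    (forall i, [set a i; b i] = fixed_points d) ->
  propP_some R G (generated d) a b.
Proof.
move=> Gs Gd Gdet ab Gdd hyp Hs sub fixd; exists (cl 1%:M).
  by apply: vertices_class; exact: unitmx1.
move=> N; have [C CP] := near_products Gs Gdet ab N.
have [GU G1 GM GV] := Gs; have du : d \in unitmx := GU _ Gdd.
have fa : mobius d (a ord0) = a ord0.
  by have : fixed_points d (a ord0) by rewrite -(fixd ord0); left.
have fb : mobius d (b ord0) = b ord0.
  by have : fixed_points d (b ord0) by rewrite -(fixd ord0); right.
have [mu mu0 da] := ell_fixed du fa; have [nu nu0 db] := ell_fixed du fb.
have mu1 := hyperbolic_eigenvalue hyp (Gdet _ Gdd) (ell_neq0 _) da.
(* The two forms are an eigenbasis for [d], so [mu * nu] is its determinant. *)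
have munu : abs (mu * nu) = 1.
  by rewrite -(Gdet _ Gdd) (det_rows_scaled (rows_ell_unit (ab ord0)) db da) mulrC.
have [D DP] := hyperbolic_reduction C (ab ord0) du da db mu0 mu1 munu.
apply: sub_finite_set (finite_image (rcoset (generated d)) (finite_bounded D Gs Gd Gdet)).
move=> _ [g [Gg near] <-].
have [n nD] := DP g (GU _ Gg) (CP g Gg near ord0).
have Hn : generated d (d ^ n) by exists n.
(* The bounded element of the coset of [g] is taken as its representative. *)
exists (d ^ n *m g); first by split; [apply: GM; [exact: sub|exact: Gg]|exact: nD].
exact: rcoset_mull Hs Hn.
Qed.

End Cosets.

Theorem theorem3p2p2 (R : realType) (k : finFieldType) (q_odd : odd #|k|)
    (Gamma : set 'M[laurent k]_2)
    (Gamma_subgroup : is_subgroup Gamma)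
    (Gamma_discrete : discrete R Gamma)
    (Gamma_det : forall g, Gamma g -> Oinf_unit (\det g))
    (r : nat) (r_ge1 : (1 <= r)%N)
    (H : set 'M[laurent k]_2)
    (H_subgroup : is_subgroup H) (H_Gamma : H `<=` Gamma)
    (a b : 'I_r -> P1 k)
    (ab_neq : forall i, a i <> b i)
    (ab_distinct : forall i j, i <> j -> [set a i; b i] <> [set a j; b j])
    (H_fix : forall h i, H h -> mobius h (a i) = a i /\ mobius h (b i) = b i) :
  (propP_some R Gamma H a b <-> propP_all R Gamma H a b)
  /\
  ((r = 1%N /\ exists delta, [/\ Gamma delta, hyperbolic R delta,
        H = generated delta &
        forall i, [set a i; b i] = fixed_points delta]) ->
    propP_some R Gamma H a b)
  /\
  ([/\ (2 <= r)%N, H = [set 1%:M] &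
       \bigcap_(i in [set: 'I_r]) [set a i; b i] = set0] ->
    propP_some R Gamma H a b)
  /\
  (commensurable Gamma (@GL2A k) ->
    ([/\ r = 1%N, H = [set 1%:M] & forall i, P1F (a i) /\ P1F (b i)] ->
      propP_some R Gamma H a b)
    /\
    ((exists c, [/\ (2 <= r)%N, H = [set 1%:M],
          \bigcap_(i in [set: 'I_r]) [set a i; b i] = [set c] & P1F c]) ->
      propP_some R Gamma H a b)).
Proof.
have Gdet g : Gamma g -> laurent_abs R k (\det g) = 1 by move/Gamma_det/(Oinf_unit_abs R).
have [GU _ _ _] := Gamma_subgroup.
have lower := propP_of_lower_bound Gamma_subgroup Gamma_discrete Gdet ab_neq H.
have cap p : (forall i, p = a i \/ p = b i) ->
    (\bigcap_(i in [set: 'I_r]) [set a i; b i]) p.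
  by move=> pab i _; case: (pab i); [left|right].
split; first exact: propP_some_all GU.
split.
  move=> [r1 [delta [Gdelta hyp HE fixd]]].
  move: H_subgroup H_Gamma; rewrite HE; subst r => Hs HG.
  exact: propP_hyperbolic.
split.
  (* No end is common to all geodesics, so the lower bound holds vacuously and the constant 1 is
     arbitrary. *)
  move=> [_ _ cap0]; apply: (lower 1) => // g p _ /cap; by rewrite cap0.
move=> comm; split.
  (* With a single geodesic both of its ends are common, and the smaller of the two bounds
     serves. *)
  move=> [r1 _ rat]; have [Fa Fb] := rat (Ordinal r_ge1).
  have [c c0 cP] := commensurable_lower_bound R Gamma_subgroup comm Fa.
  have [d d0 dP] := commensurable_lower_bound R Gamma_subgroup comm Fb.
  apply: (lower (Num.min c d)) => //; first by rewrite lt_min c0.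
  move=> g p Gg /(_ (Ordinal r_ge1))[] ->; rewrite ge_min.
    by rewrite (cP g Gg).
  by rewrite (dP g Gg) orbT.
move=> [c [_ _ capc Fc]].
have [c0 c00 c0P] := commensurable_lower_bound R Gamma_subgroup comm Fc.
by apply: (lower c0) => // g p Gg /cap; rewrite capc => ->; exact: c0P.
Qed.
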